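(* Let $\lambda$ be a straight or skew shape with $n$ boxes. For every $m\in\mathbb N=\{1,2,3,\dots\}$: (1) $\rho^{\lambda,m,+}\cong S^{\lambda}\uparrow_{S_n^1}^{D_n}$; (2) $\rho^{\lambda,m,-}\cong S^{\lambda}\uparrow_{S_n^0}^{D_n}$.
   Context: $D_n$ is the group of permutations $\pi$ of $\{\pm1,\dots,\pm n\}$ with $\pi(-i)=-\pi(i)$ and an even number of $i\in\{1,\dots,n\}$ with $\pi(i)<0$; its Coxeter generators are $s_0=(1,-2)(2,-1)$ and $s_i=(i,i+1)(-i,-i-1)$, $1\le i\le n-1$. $S_n^1=\langle s_1,\dots,s_{n-1}\rangle$ and $S_n^0=\langle s_0,s_2,\dots,s_{n-1}\rangle$, both identified with $S_n$ via $s_1\mapsto(1\,2)$ resp. $s_0\mapsto(1\,2)$ and $s_i\mapsto(i\,\,i{+}1)$ for $i\ge2$. $S^\lambda$ is the representation of $S_n$ on the space with basis the standard Young tableaux $Q$ of shape $\lambda$ filled with $1,\dots,n$, given by the Young orthogonal form $(i\,\,i{+}1)(Q)=\frac1{h}Q+\sqrt{1-\frac1{h^2}}\,Q^{s_i}$, where $h=c_{i+1}-c_i$ is the difference of contents of $i+1$ and $i$ in $Q$ and $Q^{s_i}$ is $Q$ with $i,i+1$ interchanged (content of box in row $r$, column $j$ is $j-r$). A D-Young tableau is a filling of a skew diagram by $\pm1,\dots,\pm n$, each number in one box and each box containing one number (a box of content $0$ may contain a pair $\pm i$), with $c_{-k}=-c_k$ where $c_k$ is the content of the box containing $k$; it is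 standard if entries increase along rows and down columns. A D-Young tableau with no box of content $0$ is regarded as determined by its positive-content part. For $\pi\in D_n$, $T^\pi$ denotes $T$ with each entry $k$ replaced by $\pi(k)$. $T[\lambda,m,+]$ (resp. $T[\lambda,m,-]$) is the set of standard D-Young tableaux whose smallest nonnegative content is $m$, whose positive-content boxes form the shape $\lambda$, with an even (resp. odd) number of negative entries among the positive-content boxes. For a standard D-Young tableau $T$ with content vector $(c_1,\dots,c_n)$ let $f(T)=(c_1+c_2,c_2-c_1,c_3-c_2,\dots,c_n-c_{n-1})$. $\rho^{\lambda,m,\pm}$ is the representation of $D_n$ on the real vector space with basis $T[\lambda,m,\pm]$ defined by $\rho_{s_i}(T)=\frac1{f_i(T)}T+\sqrt{1-\frac1{f_i(T)^2}}\,T^{s_i}$ for $i=0,\dots,n-1$ (here $f_i(T)=\pm1$ exactly when $T^{s_i}$ is not standard, in which case the second term vanishes). *)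

(* Defs.v *)
From HB Require Import structures.
From mathcomp Require Import all_boot all_order all_algebra all_fingroup.
Set Implicit Arguments. Unset Strict Implicit. Unset Printing Implicit Defensive.
Import Order.TTheory GRing.Theory Num.Theory.
Local Open Scope ring_scope.

(* A "matrix" M : A -> B -> R represents the linear map V_B -> V_A;    *)
(* M x y is the coefficient of the basis vector x in M(y).            *)

(* Paper composition of permutations: (comp p q) k = p (q k).
   (mathcomp's product is  (q * p) k = p (q k).) *)
Definition comp (T : finType) (p q : {perm T}) : {perm T} := (q * p)%g.

Definition is_rep (R : ringType) (gT : finType) (G : {set {perm gT}})
    (B : finType) (rho : {perm gT} -> B -> B -> R) : Prop :=
  (forall x y, rho 1%g x y = (x == y)%:R) /\
  (forall g h, g \in G -> h \in G ->
     forall x z, rho (comp g h) x z = \sum_y rho g x y * rho h y z).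

Definition rep_iso (R : ringType) (gT : finType) (G : {set {perm gT}})
    (B1 B2 : finType) (r1 : {perm gT} -> B1 -> B1 -> R)
    (r2 : {perm gT} -> B2 -> B2 -> R) : Prop :=
  exists (P : B2 -> B1 -> R) (Q : B1 -> B2 -> R),
    (forall x z, \sum_y P x y * Q y z = (x == z)%:R) /\
    (forall x z, \sum_y Q x y * P y z = (x == z)%:R) /\
    (forall g, g \in G -> forall x z,
        \sum_y P x y * r1 g y z = \sum_y r2 g x y * P y z).

Definition is_ltrans (gT : finType) (G H X : {set {perm gT}}) : bool :=
  (X \subset G) &&
  [forall g in G, #|[set x in X | comp x^-1 g \in H]| == 1%N].

(* The induced representation  sigma ^G_H , realised on the basis
   X x B, X a left transversal:  entry ((t_i,b),(t_j,b')) is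
   sigma(t_i^-1 g t_j)_{b b'} if t_i^-1 g t_j \in H, and 0 otherwise. *)
Definition Ind (R : ringType) (gT : finType) (H X : {set {perm gT}})
    (B : finType) (sigma : {perm gT} -> B -> B -> R) :
    {perm gT} -> ({x | x \in X} * B)%type -> ({x | x \in X} * B)%type -> R :=
  fun g p q =>
    let h := comp (val p.1)^-1 (comp g (val q.1)) in
    if h \in H then sigma h p.2 q.2 else 0.

(* The group D_n.  The signed number +(k+1) (resp. -(k+1)) is encoded  *)
(* as (false, k) (resp. (true, k)) with k : 'I_n.                      *)

Definition sneg n (x : bool * 'I_n) : bool * 'I_n := (~~ x.1, x.2).

Definition Dn (n : nat) : {set {perm (bool * 'I_n)}} :=
  [set p : {perm (bool * 'I_n)} | [forall x, p (sneg x) == sneg (p x)] &&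
           ~~ odd #|[set i : 'I_n | (p (false, i)).1]| ].

(* Coxeter generators: s 0 = (1,-2)(2,-1), s i = (i,i+1)(-i,-i-1). *)
Definition s (n : nat) (i : nat) : {perm (bool * 'I_n)} :=
  if i == 0%N then
    match (insub 0%N : option 'I_n), (insub 1%N : option 'I_n) with
    | Some a, Some b => (tperm (false, a) (true, b) * tperm (false, b) (true, a))%g
    | _, _ => 1%g
    end
  else
    match (insub i.-1 : option 'I_n), (insub i : option 'I_n) with
    | Some a, Some b => (tperm (false, a) (false, b) * tperm (true, a) (true, b))%g
    | _, _ => 1%g
    end.

Definition Sn1 (n : nat) : {set {perm (bool * 'I_n)}} :=
  <<[set s n (val i) | i : 'I_n & (0 < val i)%N]>>%g.
Definition Sn0 (n : nat) : {set {perm (bool * 'I_n)}} :=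
  <<[set s n (val i) | i : 'I_n & val i != 1%N]>>%g.

(* Box (r, c) (row r, column c, 0-based) has content c - r.            *)

Definition is_partition (p : seq nat) : bool := sorted (fun x y => y <= x)%N p.

Definition is_skew_shape (la mu : seq nat) : bool :=
  is_partition la && is_partition mu &&
  [forall r : 'I_(size mu), nth 0%N mu r <= nth 0%N la r]%N.

Definition box (la : seq nat) := ('I_(size la) * 'I_(head 0%N la))%type.

Definition in_shape (la mu : seq nat) (b : box la) : bool :=
  (nth 0%N mu b.1 <= b.2)%N && (b.2 < nth 0%N la b.1)%N.

Definition content (la : seq nat) (b : box la) : int := (b.2)%:Z - (b.1)%:Z.

(* Q k is the box containing the entry k+1. *)
Definition is_syt (la mu : seq nat) (n : nat) (Q : {ffun 'I_n -> box la}) : bool :=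
  injectiveb Q && [forall k, in_shape mu (Q k)] &&
  [forall k, forall l,
     (((Q k).1 == (Q l).1) && ((Q k).2 < (Q l).2)%N) ==> (k < l)%N] &&
  [forall k, forall l,
     (((Q k).2 == (Q l).2) && ((Q k).1 < (Q l).1)%N) ==> (k < l)%N].

Definition SYT (la mu : seq nat) (n : nat) :=
  {Q : {ffun 'I_n -> box la} | is_syt mu Q}.

Definition tp (n a b : nat) : {perm 'I_n} :=
  match (insub a : option 'I_n), (insub b : option 'I_n) with
  | Some x, Some y => tperm x y
  | _, _ => 1%g
  end.

(* Q^{s_i}: interchange the entries i and i+1 (1-based) *)
Definition swapQ (la : seq nat) (n i : nat) (Q : {ffun 'I_n -> box la}) :
    {ffun 'I_n -> box la} := [ffun k => Q (tp n i.-1 i k)].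

(* content c_{k+1} of the box containing the entry k+1 *)
Definition cQ (la : seq nat) (n : nat) (Q : {ffun 'I_n -> box la}) (k : nat) : int :=
  match (insub k : option 'I_n) with Some k' => content (Q k') | None => 0 end.

(* Young's orthogonal form of (i i+1), 1 <= i <= n-1, on S^{la/mu} *)
Definition yof (R : rcfType) (la mu : seq nat) (n i : nat)
    (Q' Q : SYT la mu n) : R :=
  let h : R := (cQ (val Q) i - cQ (val Q) i.-1)%:~R in
  (Q' == Q)%:R / h + (val Q' == swapQ i (val Q))%:R * Num.sqrt (1 - (h ^+ 2)^-1).

(* ---- D-Young tableaux with no content-0 box, given by their ---- *)
(* positive-content part: T k = (b, B) means the box B contains     *)
(* -(k+1) if b, and +(k+1) otherwise.                               *)
Definition dval (n : nat) (b : bool) (k : 'I_n) : int :=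
  if b then - (k.+1)%:Z else (k.+1)%:Z.

(* eps = false: even number of negative entries ("+"); eps = true: odd ("-") *)
Definition is_dtab (la mu : seq nat) (n : nat) (eps : bool)
    (T : {ffun 'I_n -> bool * box la}) : bool :=
  injectiveb (fun k => (T k).2) && [forall k, in_shape mu (T k).2] &&
  [forall k, forall l,
     (((T k).2.1 == (T l).2.1) && ((T k).2.2 < (T l).2.2)%N) ==>
       (dval (T k).1 k < dval (T l).1 l)] &&
  [forall k, forall l,
     (((T k).2.2 == (T l).2.2) && ((T k).2.1 < (T l).2.1)%N) ==>
       (dval (T k).1 k < dval (T l).1 l)] &&
  (odd #|[set k | (T k).1]| == eps).

Definition DT (la mu : seq nat) (n : nat) (eps : bool) :=
  {T : {ffun 'I_n -> bool * box la} | is_dtab mu eps T}.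

Definition minc (la mu : seq nat) : int :=
  \big[Num.min/(head 0%N la)%:Z]_(b : box la | in_shape mu b) content b.

(* content of a box once la/mu is placed so that its smallest content is m *)
Definition dcontent (la mu : seq nat) (m : nat) (b : box la) : int :=
  content b - minc la mu + m%:Z.

(* content vector: c_{k+1} of the D-tableau T (c_{-j} = - c_j) *)
Definition cvec (la mu : seq nat) (n m : nat) (T : {ffun 'I_n -> bool * box la})
    (k : nat) : int :=
  match (insub k : option 'I_n) with
  | Some k' => (if (T k').1 then -1 else 1) * dcontent mu m (T k').2
  | None => 0
  end.

Definition fD (la mu : seq nat) (n m : nat) (i : nat)
    (T : {ffun 'I_n -> bool * box la}) : int :=
  if i == 0%N then cvec mu m T 0 + cvec mu m T 1
  else cvec mu m T i - cvec mu m T i.-1.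

(* T^pi for pi in D_n: every entry e is replaced by pi(e) *)
Definition dact (la : seq nat) (n : nat) (p : {perm (bool * 'I_n)})
    (T : {ffun 'I_n -> bool * box la}) : {ffun 'I_n -> bool * box la} :=
  [ffun k => let x := (p^-1)%g (false, k) in ((T x.2).1 != x.1, (T x.2).2)].

Definition rhoGen (R : rcfType) (la mu : seq nat) (n m : nat) (eps : bool)
    (i : nat) (T' T : DT la mu n eps) : R :=
  let f : R := (fD mu m i (val T))%:~R in
  (T' == T)%:R / f + (val T' == dact (s n i) (val T))%:R * Num.sqrt (1 - (f ^+ 2)^-1).

Arguments Ind {R gT} H X {B} sigma _ _ _.
Arguments rhoGen {R} la mu {n} m eps i T' T.
Arguments yof {R} la mu {n} i Q' Q.

(* Main.v *)
Require Import Defs.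
From HB Require Import structures.
From mathcomp Require Import all_boot all_order all_algebra all_fingroup.
From mathcomp Require Import zify ring.
Import Order.TTheory GRing.Theory Num.Theory.
Set Implicit Arguments. Unset Strict Implicit. Unset Printing Implicit Defensive.
Local Open Scope ring_scope.

(** The tableaux without negative entries (for [eps = true]: with [-1] as the
    only negative entry) span a copy of S^la inside the restriction of rho, so
    Frobenius reciprocity gives a map from the induced representation to rho.
    It is onto: if T has entries [i], [-(i+1)] or [-1], [-2], the corresponding
    generator moves T to a standard tableau whose negative entries are smaller,
    with a nonzero off-diagonal coefficient, so every T is reached from a base
    tableau.  The same moves, which only depend on the set of negative entries,
    show that both sides have the same dimension.

    That the matrices of the generators do define a representation of D_n is
    proved from the braid relations in the style of Matsumoto: the value at [g]
    is obtained by stripping left descents, and the braid relations make the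
    result independent of the order of stripping. *)

(** * Reflections on content vectors and on signed permutations *)

(** Positivity of [m] is what keeps the off-diagonal coefficients alive. All contents of the placed
    shape are at least 1, so c_k has the sign of the entry. If s_i changes the sign pattern, then
    f_i is, up to sign, a sum of two such contents, hence |f_i| >= 2: the new tableau is standard
    and its coefficient is nonzero. On base tableaux f_i is a difference of contents, from which [m]
    cancels; only S^la remains.

    One measure serves the inductions on group elements, on tableaux and on cosets. Each object gets
    an integer vector on which s_i acts as a simple reflection, and the measure is the squared
    distance to (0, 1, .., n-1), the half sum of the positive roots of D_n. For group elements a
    vector without negative root values forces the identity; for sign vectors it forces a base
    tableau.

    The index of the parabolic subgroup in D_n is never computed: since the map is onto, an
    injection from the basis of the induced representation into the tableaux is enough. *)

Definition adj (i j : nat) : bool :=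
  [|| (0 < i)%N && (j == i.+1), (0 < j)%N && (i == j.+1),
      (i == 0%N) && (j == 2%N) | (i == 2%N) && (j == 0%N)].

Definition refl_act (i : nat) (c : nat -> int) (k : nat) : int :=
  if i == 0%N then
    if k == 0%N then - c 1%N else if k == 1%N then - c 0%N else c k
  else if k == i.-1 then c i else if k == i then c i.-1 else c k.

(* The value at [c] of the simple root of s_i, so that f_i(T) is [root_val i] of the
   content vector of T. *)
Definition root_val (i : nat) (c : nat -> int) : int :=
  if i == 0%N then c 0%N + c 1%N else c i - c i.-1.

Lemma adj_ind (P : nat -> nat -> Prop) :
  P 0%N 2%N -> P 2%N 0%N -> (forall i, P i.+1 i.+2) -> (forall i, P i.+2 i.+1) ->
  forall i j, adj i j -> P i j.
Proof.
move=> H02 H20 Hup Hdn i j /or4P[] /andP[].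
- by case: i => // i _ /eqP ->.
- by case: j => // j _ /eqP ->.
- by move=> /eqP -> /eqP ->.
- by move=> /eqP -> /eqP ->.
Qed.

Lemma eq_root_val i c c' : c =1 c' -> root_val i c = root_val i c'.
Proof. by move=> e; rewrite /root_val !e. Qed.

Lemma root_val_refl_act_same i c : root_val i (refl_act i c) = - root_val i c.
Proof.
case: i => [|i]; rewrite /root_val /refl_act /=; first lia.
by do ? case: eqP; lia.
Qed.

(** D_n is simply laced: for neighbours in the Coxeter diagram, s_j sends the simple root alpha_i to
    alpha_i + alpha_j. *)
Lemma root_val_refl_act_adj i j c : adj i j -> root_val i (refl_act j c) = root_val i c + root_val j c.
Proof.
move: i j; apply: adj_ind => [||i|i]; rewrite /root_val /refl_act /=; try lia.
- by do ? case: eqP; lia.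
- by do ? case: eqP; lia.
Qed.

Lemma root_val_refl_act_far i j c : i != j -> ~~ adj i j -> root_val i (refl_act j c) = root_val i c.
Proof.
case: i => [|[|i]]; case: j => [|[|j]]; rewrite /adj /root_val /refl_act //= => h1 h2;
  by do ? (case: eqP => ? //=); lia.
Qed.

Ltac split_ifs := repeat (match goal with
  |- context [if ?c then _ else _] =>
     lazymatch c with
     | context [if _ then _ else _] => fail
     | _ => let E := fresh "E" in destruct c eqn:E; try (exfalso; lia)
     end
  end; cbn iota).

(** * Coxeter relations among the generators of D_n *)

Section SignedPerm.
Variable n : nat.
Hypothesis n2 : (2 <= n)%N.
Implicit Types (g h p q : {perm (bool * 'I_n)}) (x : bool * 'I_n).

Lemma tpE (a b : nat) (k : 'I_n) : (a < n)%N -> (b < n)%N ->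
  tp n a b k = (if k == a :> nat then b else if k == b :> nat then a else k) :> nat.
Proof.
move=> an bn; rewrite /tp !insubT /=.
rewrite permE /= -!(inj_eq val_inj) /=.
by case: eqP => // _; case: eqP.
Qed.

(** s_0 and s_1 exchange the same indices 0 and 1, and s_0 also changes both signs; the pair [i.-1],
    [maxn i 1] covers both cases. *)
Lemma sE (i : nat) (b : bool) (k : 'I_n) : (i < n)%N ->
  s n i (b, k) = (b (+) ((i == 0%N) && (k < 2)%N), tp n i.-1 (maxn i 1) k).
Proof.
move=> lin; suff: ((s n i (b, k)).1 == b (+) ((i == 0%N) && (k < 2)%N)) &&
   ((s n i (b, k)).2 == tp n i.-1 (maxn i 1) k :> nat).
  by case: (s n i (b, k)) => c l /= /andP[/eqP -> /eqP e]; congr pair; apply: val_inj.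
rewrite tpE; try lia.
rewrite /s; case: i lin => [|i] lin /=.
  rewrite !insubT /=.
  rewrite permM !permE /= !xpair_eqE -!(inj_eq val_inj) /=.
  by case: b; case: k => [[|[|k]] kn] //=; rewrite ?permE /= ?xpair_eqE -?(inj_eq val_inj) //=.
rewrite !insubT /=; first lia; move=> n0.
rewrite permM !permE /= !xpair_eqE -!(inj_eq val_inj) /=.
have -> : maxn i.+1 1 = i.+1 by lia.
by case: b; case: (nat_of_ord k =P i) => ?; case: (nat_of_ord k =P i.+1) => ? /=;
  rewrite ?permE /= ?xpair_eqE -?(inj_eq val_inj) /=; do ? (case: ifP => //= ?); lia.
Qed.

Definition swap_idx (i k : nat) : nat :=
  if i is i'.+1 then if k == i' then i else if k == i then i' else k
  else if k == 0%N then 1%N else if k == 1%N then 0%N else k.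

Lemma s_fst (i : nat) x : (i < n)%N -> (s n i x).1 = x.1 (+) ((i == 0%N) && (x.2 < 2)%N).
Proof. by case: x => b k lin; rewrite sE. Qed.

Lemma s_snd (i : nat) x : (i < n)%N -> (s n i x).2 = swap_idx i x.2 :> nat.
Proof.
case: x => b k lin; rewrite sE //= tpE; try lia.
by case: i lin => [|i] lin //=; have -> : maxn i.+1 1 = i.+1 by lia.
Qed.

Lemma spair_ext (x y : bool * 'I_n) : x.1 = y.1 -> x.2 = y.2 :> nat -> x = y.
Proof. by case: x y => [b k] [c l] /= -> /val_inj ->. Qed.

Lemma sK (i : nat) : (i < n)%N -> (s n i * s n i = 1)%g.
Proof.
move=> lin; apply/permP=> -[b k]; rewrite permM perm1.
apply: spair_ext; rewrite ?s_fst ?s_snd //=;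
  by case: i lin => [|i] lin; rewrite /= ?addbF //; split_ifs; lia.
Qed.

Lemma s_far (i j : nat) : (i < n)%N -> (j < n)%N -> i != j -> ~~ adj i j ->
  (s n i * s n j = s n j * s n i)%g.
Proof.
move=> lin ljn neq nadj; apply/permP=> -[b k]; rewrite !permM.
move: neq nadj; rewrite /adj => neq nadj.
apply: spair_ext; rewrite ?s_fst ?s_snd //=;
  by case: i j neq nadj lin ljn => [|i] [|j] neq nadj lin ljn;
     rewrite /= ?addbF //; split_ifs; lia.
Qed.

Lemma s_adj (i j : nat) : (i < n)%N -> (j < n)%N -> adj i j ->
  (s n i * s n j * s n i = s n j * s n i * s n j)%g.
Proof.
move=> lin ljn aij; move: i j aij lin ljn; apply: adj_ind => [||i|i] lin ljn;
apply/permP=> -[b k]; rewrite !permM;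
apply: spair_ext; rewrite ?s_fst ?s_snd //= ?addbF //; split_ifs; lia.
Qed.
End SignedPerm.

(** Extension by 0 to all of [nat] lets neighbouring coordinates be written without bound proofs. *)
Definition vec (n : nat) (v : 'I_n -> int) (k : nat) : int :=
  if insub k is Some k' then v k' else 0.

Definition sgnval (n : nat) (x : bool * 'I_n) : int := dval x.1 x.2.

(* [i] is a left descent of [g] when [root_val i (pvec g) < 0]. *)
Definition pvec (n : nat) (g : {perm (bool * 'I_n)}) : nat -> int :=
  vec (fun k => sgnval (g^-1%g (false, k))).

(* Squared distance to the dominant vector (0, 1, .., n-1): reflections in negative
   roots decrease it. *)
Definition sqdist (n : nat) (c : nat -> int) : int := \sum_(k < n) (c k - k%:Z) ^+ 2.

Lemma vecE n (v : 'I_n -> int) (k : 'I_n) : vec v k = v k.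
Proof. by rewrite /vec valK. Qed.

Lemma vec_out n (v : 'I_n -> int) k : (n <= k)%N -> vec v k = 0.
Proof. by move=> nk; rewrite /vec insubF // ltnNge nk. Qed.

Lemma eq_vec n (v w : 'I_n -> int) : v =1 w -> vec v =1 vec w.
Proof. by move=> e k; rewrite /vec; case: insubP. Qed.

Lemma refl_actE i c k : refl_act i c k =
  if (i == 0%N) && (k < 2)%N then - c (swap_idx i k) else c (swap_idx i k).
Proof.
rewrite /refl_act; case: i => [|i] /=; last by split_ifs; rewrite ?eqxx.
by case: k => [|[|k]].
Qed.

Lemma sgnval_sneg n (x : bool * 'I_n) : sgnval (sneg x) = - sgnval x.
Proof. by case: x => [[] k]; rewrite /sgnval /dval /=; lia. Qed.

Lemma sgnval_inj n : injective (@sgnval n).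
Proof.
move=> [b k] [c l]; rewrite /sgnval /dval /= => e.
by apply: spair_ext => /=; move: e; case: b; case: c; lia.
Qed.

Section SignedGroup.
Variable n : nat.
Hypothesis n2 : (2 <= n)%N.
Implicit Types (g h p q : {perm (bool * 'I_n)}) (x : bool * 'I_n).

Lemma Dn_sneg g : g \in Dn n -> forall x, g (sneg x) = sneg (g x).
Proof. by rewrite inE => /andP[/forallP gs _] x; apply/eqP/gs. Qed.

Lemma sneg_inj_snd g : (forall x, g (sneg x) = sneg (g x)) ->
  injective (fun i => (g (false, i)).2).
Proof.
move=> gs i j /= e; case: (boolP ((g (false, i)).1 == (g (false, j)).1)) => [/eqP|] e1.
  have /perm_inj[//] : g (false, i) = g (false, j).
  by apply: spair_ext => //; rewrite e.
have : g (false, i) = g (sneg (false, j)).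
  rewrite gs; apply: spair_ext => /=; last by rewrite e.
  by move: e1; do 2 case: (_.1).
by move/perm_inj.
Qed.

(** As a sum over F_2 the parity splits along products and can be reindexed. Closure of D_n and the
    invariance of the number of negative entries mod 2 both follow from this. *)
Lemma odd_card_addb (b : pred 'I_n) : odd #|[set i | b i]| = \big[addb/false]_i b i.
Proof.
rewrite -sum1_card (big_morph odd oddD (erefl _)) big_mkcond /=.
by apply: eq_bigr => i _; rewrite inE; case: (b i).
Qed.

Lemma Dn_addb g : g \in Dn n -> \big[addb/false]_i (g (false, i)).1 = false.
Proof. by rewrite inE => /andP[_]; rewrite odd_card_addb; case: (\big[_/_]_i _). Qed.

Lemma sneg_fst g x : (forall x, g (sneg x) = sneg (g x)) ->
  (g x).1 = x.1 (+) (g (false, x.2)).1.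
Proof. by move=> gs; case: x => [[] k] //=; rewrite (gs (false, k)). Qed.

Lemma Dn_group_set : group_set (Dn n).
Proof.
apply/group_setP; split.
  rewrite inE; apply/andP; split; first by apply/forallP => x; rewrite !perm1.
  by rewrite odd_card_addb big1 // => i _; rewrite perm1.
move=> g h gD hD; have gs := Dn_sneg gD; have hs := Dn_sneg hD.
rewrite inE; apply/andP; split; first by apply/forallP => x; rewrite !permM gs hs.
rewrite odd_card_addb.
under eq_bigr => i _ do rewrite permM (sneg_fst _ hs).
rewrite big_split /= Dn_addb //=.
rewrite -(reindex_inj (sneg_inj_snd gs) (P := xpredT) (F := fun i => (h (false, i)).1)) /=.
by rewrite Dn_addb.
Qed.
Canonical Dn_group := Group Dn_group_set.

Lemma Dn_s i : (i < n)%N -> s n i \in Dn n.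
Proof.
move=> lin; rewrite inE; apply/andP; split.
  apply/forallP => x; apply/eqP/spair_ext; rewrite /sneg /= ?s_fst ?s_snd //=.
  by case: x.1; case: (_ && _).
rewrite odd_card_addb; under eq_bigr => k _ do rewrite s_fst //=.
case: i lin => [|i] lin /=; last by rewrite big1.
pose a : 'I_n := Ordinal (ltnW n2); pose b : 'I_n := Ordinal n2.
rewrite (bigD1 a) //= (bigD1 b) //= big1 // => k /andP[]; rewrite -!(inj_eq val_inj) /=; lia.
Qed.

Lemma sV i : (i < n)%N -> (s n i)^-1%g = s n i.
Proof. by move=> lin; apply/eqP; rewrite eq_invg_mul sK. Qed.

(** Vectors of group elements, content vectors and sign vectors all come from odd functions of a
    signed index, so this single computation gives the reflection action on each. *)
Lemma vec_s (w : bool * 'I_n -> int) i : (forall x, w (sneg x) = - w x) -> (i < n)%N ->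
  vec (fun k => w (s n i (false, k))) =1 refl_act i (vec (fun k => w (false, k))).
Proof.
move=> ws lin k; rewrite refl_actE; case: (ltnP k n) => kn; last first.
  rewrite !vec_out //.
    by case: ifP => //; lia.
  by rewrite /swap_idx; case: i lin => [|i] lin; split_ifs; lia.
have wE x : w x = if x.1 then - vec (fun k => w (false, k)) x.2 else vec (fun k => w (false, k)) x.2.
  by rewrite vecE; case: x => [[] l] //=; rewrite -ws.
rewrite -[k]/(val (Ordinal kn)) vecE wE s_fst // s_snd //=.
Qed.

Lemma pvec_s g i : g \in Dn n -> (i < n)%N ->
  pvec (Defs.comp (s n i) g) =1 refl_act i (pvec g).
Proof.
move=> gD lin; have gs := Dn_sneg (groupVr (G := Dn_group) gD).
move=> k; rewrite /pvec -(vec_s (w := fun x => sgnval (g^-1%g x))) //; last first.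
  by move=> x; rewrite gs sgnval_sneg.
by apply: eq_vec => {}k; rewrite /Defs.comp invMg sV // permM.
Qed.

Lemma sqdist_ge0 (c : nat -> int) : 0 <= sqdist n c.
Proof. by apply: sumr_ge0 => k _; rewrite sqr_ge0. Qed.

Lemma eq_sqdist (c c' : nat -> int) : c =1 c' -> sqdist n c = sqdist n c'.
Proof. by move=> e; apply: eq_bigr => k _; rewrite e. Qed.

(** With rho = (0, 1, .., n-1), reflecting c in a root alpha of squared length 2 adds 2 (c, alpha)
    (rho, alpha) to |c - rho|^2. The factor is the same for all i, including 0, because rho takes
    the value 1 on every simple root. *)
Lemma sqdist_refl_act i c : (i < n)%N -> sqdist n (refl_act i c) = sqdist n c + root_val i c *+ 2.
Proof.
move=> lin; have an : (i.-1 < n)%N by lia.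
have bn : (maxn i 1 < n)%N by lia.
pose a := Ordinal an; pose b := Ordinal bn.
have ba : b != a by rewrite -(inj_eq val_inj) /=; lia.
rewrite /sqdist (bigD1 a) //= (bigD1 b) //= [in RHS](bigD1 a) //= [in RHS](bigD1 b) //=.
under eq_bigr => k /andP[ka kb].
  have -> : refl_act i c k = c k.
    move: ka kb; rewrite -!(inj_eq val_inj) refl_actE /=.
    case: i lin {an bn a b ba} => [|i] lin; rewrite /swap_idx /=; split_ifs; lia.
  over.
move: (\sum_(_ < n | _) _) => S; clear a b ba an bn.
case: i lin => [|i] lin; rewrite /refl_act /root_val /=.
  by rewrite /maxn /= mulr2n; ring.
have -> : maxn i.+1 1 = i.+1 by lia.
rewrite !eqxx; have -> : (i.+1 == i) = false by lia.
have -> : i.+1%:Z = i%:Z + 1 by lia.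
by rewrite mulr2n; ring.
Qed.

End SignedGroup.

(** * Descents, and extending braid relations to D_n *)

Section Descents.
Variable n : nat.
Implicit Types (g h p q : {perm (bool * 'I_n)}) (x : bool * 'I_n).

Lemma pvec_bound g k : (k < n)%N -> (0 < `|pvec g k| <= n)%N.
Proof.
move=> kn; rewrite -[k]/(val (Ordinal kn)) /pvec vecE /sgnval /dval.
move: (g^-1%g _) => [b [j jn]]; case: ifP => _ /=; lia.
Qed.

Lemma pvec_neq g k l : g \in Dn n -> (k < n)%N -> (l < n)%N -> k != l ->
  `|pvec g k|%N != `|pvec g l|%N.
Proof.
move=> gD kn ln; apply: contra => /eqP e.
have hs := Dn_sneg (groupVr (G := Dn_group n) gD).
have e2 : (g^-1%g (false, Ordinal kn)).2 = (g^-1%g (false, Ordinal ln)).2.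
  apply: val_inj; move: e.
  rewrite -[k]/(val (Ordinal kn)) -[l]/(val (Ordinal ln)) /pvec !vecE /sgnval /dval.
  move: (g^-1%g _) => [b i]; move: (g^-1%g _) => [c j] /=.
  by do 2 case: ifP => _; lia.
by have /(congr1 val)/= -> := sneg_inj_snd hs e2.
Qed.

Hypothesis n2 : (2 <= n)%N.

Lemma root_val_pvec_neq0 g i : g \in Dn n -> (i < n)%N -> root_val i (pvec g) != 0.
Proof.
move=> gD lin; rewrite /root_val; case: i lin => [|i] lin /=.
  by have := pvec_neq gD (ltnW n2) n2 isT; lia.
by have := pvec_neq gD lin (ltnW lin) (negbT (gtn_eqF (ltnSn i))); lia.
Qed.

(** Without descents the entries satisfy |u_0| < u_1 < .. < u_{n-1}, with absolute values in 1..n.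
    Counting up from u_1 >= 2 and down from u_{n-1} <= n gives u_k = k + 1 for k > 0. *)
Lemma no_descent_eq1 g : g \in Dn n -> (forall i, (i < n)%N -> 0 <= root_val i (pvec g)) -> g = 1%g.
Proof.
move=> gD nd; set u := pvec g.
have hD := groupVr (G := Dn_group n) gD.
have step k : (k.+1 < n)%N -> u k < u k.+1.
  move=> kn; have := nd _ kn; have := root_val_pvec_neq0 gD kn; rewrite /root_val /= -/u; lia.
have u01 : - u 0%N < u 1%N.
  by have := nd _ (ltnW n2); have := root_val_pvec_neq0 gD (ltnW n2); rewrite /root_val /= -/u; lia.
have u0 := pvec_bound g (ltnW n2).
have low k : (k.+1 < n)%N -> (k.+2)%:Z <= u k.+1.
  elim: k => [|k IH] kn; first by have := step _ kn; rewrite -/u in u0; lia.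
  by have := step _ kn; have := IH (ltnW kn); lia.
have up d : forall k, (k < n)%N -> (n <= k.+1 + d)%N -> u k <= (k.+1)%:Z.
  elim: d => [|d IH] k kn nk; first by have := pvec_bound g kn; rewrite -/u; lia.
  case: (ltnP k.+1 n) => kn'; last by have := pvec_bound g kn; rewrite -/u; lia.
  by have := step _ kn'; have := IH _ kn'; lia.
have hS (k : 'I_n) : k != 0%N :> nat -> g^-1%g (false, k) = (false, k).
  move=> k0; apply: sgnval_inj.
  have := vecE (fun k => sgnval (g^-1%g (false, k))) k => /= <-.
  rewrite -/(pvec g) -/u /sgnval /dval /=.
  case: k k0 => [[|k] kn] //= _.
  by have := low _ kn; have := up n _ kn (leq_addl _ _); lia.
pose o : 'I_n := Ordinal (ltnW n2).
(* The inequalities leave u_0 = 1 or -1; the even number of sign changes decides. *)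
have h0 : g^-1%g (false, o) = (false, o).
  apply: spair_ext => /=.
    have := Dn_addb hD; rewrite (bigD1 o) //= big1 ?addbF // => k ko.
    by rewrite hS.
  have := vecE (fun k => sgnval (g^-1%g (false, k))) o; rewrite -/(pvec g) -/u /= /sgnval /dval.
  have := up n _ n2 (leq_addl _ _); have := step _ n2; move: (g^-1%g _) => [b j] /=.
  by case: b; lia.
have hF k : g^-1%g (false, k) = (false, k).
  by case: (eqVneq (val k) 0%N) => [k0|]; [rewrite (_ : k = o) //; apply: val_inj | apply: hS].
apply: invg_inj; rewrite invg1; apply/permP => -[[] k]; rewrite perm1 //.
by rewrite -[(true, k)]/(sneg (false, k)) Dn_sneg // hF.
Qed.

Lemma sqdist_descent g i : g \in Dn n -> (i < n)%N ->
  sqdist n (pvec (Defs.comp (s n i) g)) = sqdist n (pvec g) + root_val i (pvec g) *+ 2.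
Proof. by move=> gD lin; rewrite -sqdist_refl_act // (eq_sqdist n (pvec_s n2 gD lin)). Qed.

Lemma Dn_comp g h : g \in Dn n -> h \in Dn n -> Defs.comp g h \in Dn n.
Proof. by move=> gD hD; rewrite /Defs.comp (groupM (G := Dn_group n)). Qed.

Lemma comp_sK g i : (i < n)%N -> Defs.comp (s n i) (Defs.comp (s n i) g) = g.
Proof. by move=> lin; rewrite /Defs.comp -mulgA sK // mulg1. Qed.

Lemma Dn_ind (P : {perm (bool * 'I_n)} -> Prop) : P 1%g ->
  (forall i g, (i < n)%N -> g \in Dn n -> root_val i (pvec g) < 0 ->
     P (Defs.comp (s n i) g) -> P g) ->
  forall g, g \in Dn n -> P g.
Proof.
move=> P1 PS g; have [N] := ubnP `|sqdist n (pvec g)|; elim: N g => // N IH g ltN gD.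
case: (pickP (fun i : 'I_n => root_val i (pvec g) < 0)) => [i fi|nd]; last first.
  rewrite (no_descent_eq1 gD) // => i lin; rewrite leNgt.
  by have := nd (Ordinal lin) => /= ->.
apply: (PS i) => //; apply: IH; last by apply: Dn_comp => //; apply: Dn_s.
have := sqdist_descent gD (ltn_ord i); have := sqdist_ge0 n (pvec g).
have := sqdist_ge0 n (pvec (Defs.comp (s n i) g)).
by move: ltN fi; lia.
Qed.
End Descents.

Section Extension.
Variables (n : nat) (A : pzRingType) (r : nat -> A).
Hypothesis n2 : (2 <= n)%N.
Hypothesis r_sq : forall i, (i < n)%N -> r i * r i = 1.
Hypothesis r_far : forall i j, (i < n)%N -> (j < n)%N -> i != j -> ~~ adj i j ->
  r i * r j = r j * r i.
Hypothesis r_adj : forall i j, (i < n)%N -> (j < n)%N -> adj i j ->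
  r i * r j * r i = r j * r i * r j.
Implicit Types (g h : {perm (bool * 'I_n)}).

(** Every stripped descent lowers the level, so one more unit of fuel than the level of [g] reaches
    the identity. *)
Fixpoint Dn_ext_fuel (k : nat) (g : {perm (bool * 'I_n)}) : A :=
  if k is k'.+1 then
    if [pick i : 'I_n | root_val i (pvec g) < 0] is Some i
    then r i * Dn_ext_fuel k' (Defs.comp (s n i) g) else 1
  else 1.

Local Notation level g := `|sqdist n (pvec g)|%N.

Definition Dn_ext g : A := Dn_ext_fuel (level g).+1 g.

Lemma level_descent g i : g \in Dn n -> (i < n)%N -> root_val i (pvec g) < 0 ->
  (level (Defs.comp (s n i) g) < level g)%N.
Proof.
move=> gD lin fi; have := sqdist_descent n2 gD lin; have := sqdist_ge0 n (pvec g).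
by have := sqdist_ge0 n (pvec (Defs.comp (s n i) g)); lia.
Qed.

Lemma Dn_comp_s g i : g \in Dn n -> (i < n)%N -> Defs.comp (s n i) g \in Dn n.
Proof. by move=> gD lin; apply: Dn_comp => //; apply: Dn_s. Qed.

Lemma Dn_ext_fuel_stable k l g : g \in Dn n -> (level g < l)%N -> (level g < k)%N ->
  Dn_ext_fuel k g = Dn_ext_fuel l g.
Proof.
elim: k l g => [|k IH] [|l] g gD //= gl gk.
case: pickP => // i fi; congr (_ * _).
have lt := level_descent gD (ltn_ord i) fi.
have D' := Dn_comp_s gD (ltn_ord i).
by apply: IH => //; lia.
Qed.

(** This is the independence of the chosen descent. The definition strips some j; by induction on
    the level the values at s_i g and s_j g may be unfolded along any descent, until both sides
    reach the same element after a commutation or a braid move. *)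
Lemma Dn_ext_descent g i : g \in Dn n -> (i < n)%N -> root_val i (pvec g) < 0 ->
  Dn_ext g = r i * Dn_ext (Defs.comp (s n i) g).
Proof.
have [N] := ubnP (level g); elim: N g i => // N IH g i ltN gD lin fi.
rewrite {1}/Dn_ext /=; case: pickP => [j fj|/(_ (Ordinal lin))]; last by rewrite /= fi.
have ljn := ltn_ord j.
have lt x k : x \in Dn n -> (k < n)%N -> root_val k (pvec x) < 0 -> (level x < N.+1)%N ->
    (level (Defs.comp (s n k) x) < N)%N.
  by move=> xD kn fk; have := level_descent xD kn fk; lia.
rewrite (Dn_ext_fuel_stable (l := (level (Defs.comp (s n j) g)).+1)) ?Dn_comp_s //;
  last by apply: level_descent.
rewrite -/(Dn_ext _).
have [<-//|nij] := eqVneq (j : nat) i.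
pose sj := Defs.comp (s n j); pose si := Defs.comp (s n i); rewrite -/(sj g) -/(si g).
have siD x : x \in Dn n -> si x \in Dn n by move=> xD; apply: Dn_comp_s.
have sjD x : x \in Dn n -> sj x \in Dn n by move=> xD; apply: Dn_comp_s.
have vfi x k : x \in Dn n -> root_val k (pvec (si x)) = root_val k (refl_act i (pvec x)).
  by move=> xD; apply: eq_root_val => l; rewrite pvec_s.
have vfj x k : x \in Dn n -> root_val k (pvec (sj x)) = root_val k (refl_act j (pvec x)).
  by move=> xD; apply: eq_root_val => l; rewrite pvec_s.
have nji : i != j by rewrite eq_sym.
have lgi : (level (si g) < N)%N by apply: lt.
have lgj : (level (sj g) < N)%N by apply: lt.
have [aij|nadj] := boolP (adj i j); last first.
  have nadj' : ~~ adj j i by move: nadj; rewrite /adj; lia.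
  rewrite (IH (sj g) i) ?(IH (si g) j) ?vfi ?vfj ?root_val_refl_act_far ?siD ?sjD //.
  by rewrite !mulrA r_far // /Defs.comp -/si -!mulgA s_far.
have aji : adj j i by move: aij; rewrite /adj; lia.
(* The root values of i and j are negative at [g], hence so is their sum. Every step of both words
   s_i s_j s_i and s_j s_i s_j therefore strips a descent. *)
have fij : root_val i (pvec (sj g)) < 0 by rewrite vfj // root_val_refl_act_adj //; lia.
have fji : root_val j (pvec (si g)) < 0 by rewrite vfi // root_val_refl_act_adj //; lia.
have fjij : root_val j (pvec (si (sj g))) < 0.
  by rewrite vfi ?sjD // root_val_refl_act_adj // !vfj // root_val_refl_act_same root_val_refl_act_adj //; lia.
have fiji : root_val i (pvec (sj (si g))) < 0.
  by rewrite vfj ?siD // root_val_refl_act_adj // !vfi // root_val_refl_act_same root_val_refl_act_adj //; lia.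
have lgij : (level (si (sj g)) < N)%N by apply: lt; rewrite ?sjD //; lia.
have lgji : (level (sj (si g)) < N)%N by apply: lt; rewrite ?siD //; lia.
have D1 := siD _ gD; have D2 := sjD _ gD; have D3 := siD _ D2; have D4 := sjD _ D1.
rewrite (IH (sj g) i) // -/(si _) (IH (si (sj g)) j) // -/(sj _).
rewrite (IH (si g) j) // -/(sj _) (IH (sj (si g)) i) // -/(si _).
rewrite !mulrA r_adj //; congr (_ * Dn_ext _).
by rewrite /si /sj /Defs.comp -!mulgA !(mulgA (s n _)) s_adj.
Qed.

Lemma Dn_ext_s g i : g \in Dn n -> (i < n)%N -> Dn_ext (Defs.comp (s n i) g) = r i * Dn_ext g.
Proof.
move=> gD lin; have := root_val_pvec_neq0 n2 gD lin; rewrite neq_lt => /orP[fi|fi].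
  by rewrite (Dn_ext_descent gD lin fi) mulrA r_sq // mul1r.
rewrite (@Dn_ext_descent _ i) ?Dn_comp_s //; last first.
  by rewrite (eq_root_val _ (pvec_s n2 gD lin)) root_val_refl_act_same oppr_lt0.
by rewrite comp_sK.
Qed.

Lemma Dn_ext1 : Dn_ext 1%g = 1.
Proof.
rewrite /Dn_ext /=; case: pickP => // i; rewrite /root_val.
have E k : (k < n)%N -> pvec (1%g : {perm (bool * 'I_n)}) k = k.+1%:Z.
  move=> kn; apply: etrans (vecE _ (Ordinal kn)) _.
  by rewrite invg1 perm1.
have := ltn_ord i; case: (nat_of_ord i) => [|k] kn /=; rewrite !E; lia.
Qed.

Lemma Dn_extM g h : g \in Dn n -> h \in Dn n -> Dn_ext (Defs.comp g h) = Dn_ext g * Dn_ext h.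
Proof.
move=> gD hD; move: g gD; apply: Dn_ind => // [|i g lin gD _ IH].
  by rewrite Dn_ext1 mul1r /Defs.comp mulg1.
have := Dn_ext_s (Dn_comp_s gD lin) lin; rewrite comp_sK // => ->.
rewrite -mulrA -IH -Dn_ext_s ?Dn_comp_s //; last by apply: Dn_comp => //; apply: Dn_comp_s.
by rewrite /Defs.comp -!mulgA sK // mulg1.
Qed.

Lemma Dn_ext_gen i : (i < n)%N -> Dn_ext (s n i) = r i.
Proof.
move=> lin; rewrite -[RHS]mulr1 -Dn_ext1 -Dn_ext_s ?(group1 (Dn_group n)) //.
by rewrite /Defs.comp mul1g.
Qed.
End Extension.

(** * Standard D-tableaux *)

Lemma nth_partition (p : seq nat) r r' : is_partition p -> (r <= r')%N ->
  (nth 0 p r' <= nth 0 p r)%N.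
Proof.
move=> sp rr'; case: (ltnP r' (size p)) => [r'p|/(nth_default 0%N) -> //].
have tr : transitive (fun x y => y <= x)%N by move=> x y z xy yz; apply: leq_trans yz xy.
by apply: (sorted_leq_nth tr _ 0%N sp) => //; rewrite ?inE //; apply: leq_ltn_trans r'p.
Qed.

Lemma sum_interval (a b N : nat) : (b <= N)%N ->
  (\sum_(c < N) ((a <= c) && (c < b)) = b - a)%N.
Proof.
move=> bN; suff -> : (\sum_(c < N) ((a <= c) && (c < b)) = minn b N - a)%N by lia.
elim: N {bN} => [|N IH]; first by rewrite big_ord0; lia.
rewrite big_ord_recr /= IH; lia.
Qed.

Lemma sumn_nth (p : seq nat) (N : nat) : (forall r, (N <= r)%N -> nth 0%N p r = 0%N) ->
  sumn p = (\sum_(r < N) nth 0%N p r)%N.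
Proof.
elim: p N => [|x p IH] [|N] pN; rewrite ?big_ord0 //.
- by rewrite big1 // => i _; rewrite nth_nil.
- by rewrite /= (IH 0%N) ?big_ord0 => [|r _]; [have := pN 0%N isT => /= -> | apply: (pN r.+1)].
- by rewrite big_ord_recl /= (IH N) // => r Nr; apply: (pN r.+1).
Qed.

(** This is [is_dtab] freed from the parity of the negative entries, which [flip] reverses. *)
Definition is_std (la mu : seq nat) (n : nat) (T : {ffun 'I_n -> bool * box la}) : bool :=
  injectiveb (fun k => (T k).2) && [forall k, in_shape mu (T k).2] &&
  [forall k, forall l,
     (((T k).2.1 == (T l).2.1) && ((T k).2.2 < (T l).2.2)%N) ==>
       (dval (T k).1 k < dval (T l).1 l)] &&
  [forall k, forall l,
     (((T k).2.2 == (T l).2.2) && ((T k).2.1 < (T l).2.1)%N) ==>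
       (dval (T k).1 k < dval (T l).1 l)].

Definition entry (la : seq nat) (n : nat) (T : {ffun 'I_n -> bool * box la}) (k : 'I_n) : int :=
  dval (T k).1 k.

Lemma is_stdP (la mu : seq nat) (n : nat) (T : {ffun 'I_n -> bool * box la}) :
  reflect [/\ injective (fun k => (T k).2), forall k, in_shape mu (T k).2,
    forall k l, (T k).2.1 = (T l).2.1 -> ((T k).2.2 < (T l).2.2)%N -> entry T k < entry T l
    & forall k l, (T k).2.2 = (T l).2.2 -> ((T k).2.1 < (T l).2.1)%N -> entry T k < entry T l]
  (is_std mu T).
Proof.
apply: (iffP idP) => [/andP[/andP[/andP[/injectiveP iT /forallP sT] /forallP rT] /forallP cT]|].
  split=> // k l /eqP e lt.
    by have /forallP/(_ l)/implyP := rT k; apply; rewrite e.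
  by have /forallP/(_ l)/implyP := cT k; apply; rewrite e.
move=> [iT sT rT cT]; rewrite /is_std.
apply/andP; split; [apply/andP; split; [apply/andP; split|]|].
- exact/injectiveP.
- exact/forallP.
- by apply/forallP=> k; apply/forallP=> l; apply/implyP=> /andP[/eqP e lt]; apply: rT.
- by apply/forallP=> k; apply/forallP=> l; apply/implyP=> /andP[/eqP e lt]; apply: cT.
Qed.

Lemma dvalE n b (k : 'I_n) : dval b k = if b then - k.+1%:Z else k.+1%:Z.
Proof. by []. Qed.

(* Negating the entry 1 keeps a filling standard and exchanges s_0 and s_1. *)
Definition flip (la : seq nat) (n : nat) (T : {ffun 'I_n -> bool * box la}) :
    {ffun 'I_n -> bool * box la} :=
  [ffun k => ((T k).1 (+) (k == 0%N :> nat), (T k).2)].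

Lemma flipK la n : involutive (@flip la n).
Proof.
move=> T; apply/ffunP => k; rewrite !ffunE /= -addbA addbb addbF.
by case: (T k).
Qed.

(** All other entries have absolute value at least 2, so they compare with 1 as with -1. *)
Lemma is_std_flip (la mu : seq nat) (n : nat) (T : {ffun 'I_n -> bool * box la}) :
  is_std mu (flip T) = is_std mu T.
Proof.
suff imp (U : {ffun 'I_n -> bool * box la}) : is_std mu U -> is_std mu (flip U).
  by apply/idP/idP => [/imp|/imp //]; rewrite flipK.
move=> /is_stdP[iT sT rT cT]; have E k : (flip U k).2 = (U k).2 by rewrite ffunE.
have flt k l : k != l -> entry U k < entry U l -> entry (flip U) k < entry (flip U) l.
  rewrite /entry !ffunE /= !dvalE -(inj_eq val_inj) /=.
  by case: (nat_of_ord k) => [|?]; case: (nat_of_ord l) => [|?];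
     case: (U k).1; case: (U l).1; rewrite /=; lia.
apply/is_stdP; split.
- by move=> k l; rewrite !E; apply: iT.
- by move=> k; rewrite E.
- move=> k l; rewrite !E => e lt; apply: flt; last exact: rT.
  by apply: contraTneq lt => ->; rewrite ltnn.
- move=> k l; rewrite !E => e lt; apply: flt; last exact: cT.
  by apply: contraTneq lt => ->; rewrite ltnn.
Qed.

Lemma dact_s (la : seq nat) (n : nat) (T : {ffun 'I_n -> bool * box la}) i k :
  (2 <= n)%N -> (i < n)%N ->
  dact (s n i) T k = ((T (s n i (false, k)).2).1 (+) ((i == 0%N) && (k < 2)%N),
                      (T (s n i (false, k)).2).2).
Proof.
move=> n2 lin; rewrite ffunE sV //= s_fst //=.
by case: (T _).1; case: (_ && _).
Qed.

(** Conjugation by the sign change of 1, which is not in D_n, turns s_0 into s_1; statements about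
    s_0 reduce to the unsigned generators this way. *)
Lemma dact_s0 (la : seq nat) (n : nat) (T : {ffun 'I_n -> bool * box la}) :
  (2 <= n)%N -> dact (s n 0) T = flip (dact (s n 1) (flip T)).
Proof.
move=> n2; apply/ffunP => k; rewrite dact_s //; last by lia.
rewrite [RHS]ffunE dact_s // [flip T _]ffunE /= addbF; set y := (s n 1 _).2.
have -> : (s n 0 (false, k)).2 = y by apply: val_inj; rewrite /= !s_snd //; lia.
congr (_, _); rewrite -addbA; congr (_ (+) _).
by rewrite /y s_snd //= /swap_idx; case: (nat_of_ord k) => [|[|j]].
Qed.

Lemma dcontent_gt0 (la mu : seq nat) (m : nat) (b : box la) : (0 < m)%N -> in_shape mu b ->
  0 < dcontent mu m b.
Proof.
move=> m0 sb; rewrite /dcontent; have : minc la mu <= content b by apply: bigmin_le_cond.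
by lia.
Qed.

(** * Order and contents in standard fillings of a skew shape *)

Section Tableaux.
Variables (n : nat) (la mu : seq nat).
Hypothesis (skew : is_skew_shape la mu) (sz : (sumn la - sumn mu)%N = n).
Implicit Types (T : {ffun 'I_n -> bool * box la}).

Lemma skew_le r : (nth 0 mu r <= nth 0 la r)%N.
Proof.
have /andP[_ /forallP le] := skew.
case: (ltnP r (size mu)) => [rs|/(nth_default 0%N) -> //]; exact: (le (Ordinal rs)).
Qed.

Lemma card_shape : #|[set b : box la | in_shape mu b]| = n.
Proof.
have /andP[/andP[pla pmu] _] := skew.
rewrite -sum1_card big_mkcond /= -sz.
rewrite (eq_bigr (fun b : box la =>
   nat_of_bool ((nth 0%N mu b.1 <= b.2)%N && (b.2 < nth 0%N la b.1)%N))); last first.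
  by move=> b _; rewrite inE /in_shape; case: (_ && _).
rewrite -(pair_bigA _ (fun (r : 'I_(size la)) (c : 'I_(head 0%N la)) =>
   nat_of_bool ((nth 0%N mu r <= c)%N && (c < nth 0%N la r)%N))) /=.
under eq_bigr => r _.
  rewrite sum_interval; last by rewrite -nth0; apply: nth_partition.
  over.
rewrite sumnB; last by move=> r _; apply: skew_le.
rewrite -!sumn_nth // => r sr; last exact: nth_default.
by have := skew_le r; rewrite (nth_default _ sr); lia.
Qed.

Lemma std_surj T (b : box la) : is_std mu T -> in_shape mu b -> exists k, (T k).2 = b.
Proof.
move=> /is_stdP[iT sT _ _] sb.
have : [set (T k).2 | k : 'I_n] == [set b : box la | in_shape mu b].
  rewrite eqEcard; apply/andP; split.
    by apply/subsetP=> c /imsetP[k _ ->]; rewrite inE.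
  by rewrite card_shape card_imset // card_ord.
by move=> /eqP/setP/(_ b); rewrite inE sb => /imsetP[k _ ->]; exists k.
Qed.

Lemma shape_convex (b b' : box la) (r c : nat) : in_shape mu b -> in_shape mu b' ->
  (b.1 <= r <= b'.1)%N -> (b.2 <= c <= b'.2)%N ->
  exists2 d : box la, in_shape mu d & d.1 = r :> nat /\ d.2 = c :> nat.
Proof.
have /andP[/andP[pla pmu] _] := skew.
move=> /andP[b1 b2] /andP[b1' b2'] /andP[r1 r2] /andP[c1 c2].
have rl : (r < size la)%N by apply: leq_ltn_trans r2 _.
have cl : (c < head 0%N la)%N by apply: leq_ltn_trans c2 _.
exists (Ordinal rl, Ordinal cl) => //; rewrite /in_shape /=.
by have := nth_partition pla r2; have := nth_partition pmu r1; lia.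
Qed.

(** The comparison passes through the corner box in the row of [k] and the column of [l], which is
    in the shape by convexity and is filled by [std_surj]. *)
Lemma std_le T k l : is_std mu T -> k != l ->
  ((T k).2.1 <= (T l).2.1)%N -> ((T k).2.2 <= (T l).2.2)%N -> entry T k < entry T l.
Proof.
move=> sT kl r c; have /is_stdP[iT hT rT cT] := sT.
have hr : ((T k).2.1 <= (T k).2.1 <= (T l).2.1)%N by rewrite leqnn.
have hc : ((T k).2.2 <= (T l).2.2 <= (T l).2.2)%N by rewrite c leqnn.
have [d sd [d1 d2]] := shape_convex (hT k) (hT l) hr hc.
have [j jd] := std_surj sT sd.
have kj : k != j -> entry T k < entry T j.
  move=> nkj; apply: rT; first by apply: val_inj; rewrite jd /= d1.
  rewrite jd d2 ltn_neqAle c andbT; apply: contra nkj => /eqP e.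
  apply/eqP/iT; rewrite jd; case: (T k).2 e d1 => x y /= e d1.
  by case: (d) d1 d2 => x' y' /= d1 d2; congr pair; apply: val_inj; rewrite /= ?d2.
have jl : j != l -> entry T j < entry T l.
  move=> njl; apply: cT; first by apply: val_inj; rewrite jd /= d2.
  rewrite jd d1 ltn_neqAle r andbT; apply: contra njl => /eqP e.
  apply/eqP/iT; rewrite jd; case: (T l).2 e d2 => x y /= e d2.
  by case: (d) d1 d2 => x' y' /= d1 d2; congr pair; apply: val_inj; rewrite /= ?d1.
have [ekj|/kj lt1] := eqVneq k j; first by rewrite ekj; apply: jl; rewrite -ekj.
by have [<- //|/jl] := eqVneq j l; apply: lt_trans.
Qed.

Lemma std_between T k l (r c : nat) : is_std mu T ->
  ((T k).2.1 <= r <= (T l).2.1)%N -> ((T k).2.2 <= c <= (T l).2.2)%N ->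
  ((r != (T k).2.1) || (c != (T k).2.2))%N -> ((r != (T l).2.1) || (c != (T l).2.2))%N ->
  exists j, [/\ (T j).2.1 = r :> nat, (T j).2.2 = c :> nat, entry T k < entry T j
               & entry T j < entry T l].
Proof.
move=> sT hr hc nk nl; have /is_stdP[_ hT _ _] := sT.
have [d sd [d1 d2]] := shape_convex (hT k) (hT l) hr hc.
have [j jd] := std_surj sT sd.
exists j; rewrite jd d1 d2; split => //; apply: std_le => //; rewrite ?jd ?d1 ?d2; try lia.
  by apply: contraTneq nk => ->; rewrite jd d1 d2 !eqxx.
by apply: contraTneq nl => <-; rewrite jd d1 d2 !eqxx.
Qed.

Variable m : nat.
Hypothesis m0 : (0 < m)%N.

Lemma cvecE T (k : 'I_n) : cvec mu m T k = (if (T k).1 then -1 else 1) * dcontent mu m (T k).2.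
Proof. exact: (vecE (fun k => (if (T k).1 then -1 else 1) * dcontent mu m (T k).2)). Qed.

(** Contents being positive, equal values would force equal signs and boxes on one diagonal. Between
    two such boxes lie two further entries, whereas entries of one sign at distance at most 2 leave
    room for one. Distance 1 is needed for f_i, distance 2 for the braid relation. *)
Lemma cvec_neq T (k l : 'I_n) : is_std mu T -> (k < l <= k.+2)%N ->
  cvec mu m T k != cvec mu m T l.
Proof.
move=> sT kl; have /is_stdP[iT hT _ _] := sT; apply/eqP; rewrite !cvecE => e.
have := dcontent_gt0 m0 (hT k); have := dcontent_gt0 m0 (hT l) => gl gk.
have ss : (T k).1 = (T l).1 by move: e; case: (T k).1; case: (T l).1 => //; lia.
have ec : content (T k).2 = content (T l).2.
  by move: e; rewrite ss /dcontent; case: (T l).1; lia.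
(* The two entries are those just right of and just below the box of [p]. *)
have diag p q : ((T p).2.1 < (T q).2.1)%N -> content (T p).2 = content (T q).2 ->
    exists j j' : 'I_n, [/\ j != j' :> nat, entry T p < entry T j, entry T j < entry T q,
                     entry T p < entry T j' & entry T j' < entry T q].
  rewrite /content => lt epq.
  have [||||j [j1 j2 j3 j4]] := @std_between T p q (T p).2.1 (T p).2.2.+1 sT; try lia.
  have [||||j' [j1' j2' j3' j4']] := @std_between T p q (T p).2.1.+1 (T p).2.2 sT; try lia.
  exists j, j'; split => //; apply: contra_eqN j1' => /eqP/val_inj <-; rewrite j1.
  by lia.
have bet p q : (T p).1 = (T q).1 -> (p - q <= 2)%N -> (q - p <= 2)%N ->
    ((T p).2.1 < (T q).2.1)%N -> content (T p).2 = content (T q).2 -> False.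
  move=> spq d1 d2 lt epq; have [j [j' [njj]]] := diag p q lt epq.
  rewrite /entry !dvalE spq.
  by case: (T q).1; case: (T j).1; case: (T j').1; lia.
have [lt|lt|e1] := ltngtP (T k).2.1 (T l).2.1.
- by apply: (bet k l) => //; lia.
- by apply: (bet l k) => //; lia.
have ekl : (T k).2 = (T l).2.
  move: e1 ec; rewrite /content; case: (T k).2 => x y; case: (T l).2 => x' y' /= e2 h.
  by congr pair; apply: val_inj => /=; lia.
by move: kl; rewrite (iT _ _ ekl); lia.
Qed.

End Tableaux.

Definition sgvec (la : seq nat) (n : nat) (T : {ffun 'I_n -> bool * box la}) : nat -> int :=
  vec (fun k => if (T k).1 then -1 else 1).

(** * Action of the generators on standard fillings *)

Section Swaps.
Variables (n : nat) (la mu : seq nat).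
Hypothesis (n2 : (2 <= n)%N) (skew : is_skew_shape la mu) (sz : (sumn la - sumn mu)%N = n).
Variable m : nat.
Hypothesis m0 : (0 < m)%N.
Implicit Types (T : {ffun 'I_n -> bool * box la}).

Lemma vec_dact (q : bool * box la -> int) T i : (forall b c, q (~~ b, c) = - q (b, c)) ->
  (i < n)%N -> vec (fun k => q (dact (s n i) T k)) =1 refl_act i (vec (fun k => q (T k))).
Proof.
move=> qs lin k.
pose w (x : bool * 'I_n) := q ((T x.2).1 (+) x.1, (T x.2).2).
have ws x : w (sneg x) = - w x by rewrite /w /= addbN qs.
rewrite (eq_vec (w := fun k => w (s n i (false, k)))); last first.
  by move=> l; rewrite dact_s // /w s_fst.
rewrite vec_s // !refl_actE; congr (if _ then - _ else _); apply: eq_vec => l;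
  by rewrite /w addbF; case: (T l).
Qed.

Lemma cvec_dact T i : (i < n)%N ->
  cvec mu m (dact (s n i) T) =1 refl_act i (cvec mu m T).
Proof.
by apply: (vec_dact (q := fun x => (if x.1 then -1 else 1) * dcontent mu m x.2)) => -[] c /=;
  rewrite ?mulN1r ?mul1r ?opprK.
Qed.

Lemma sgvec_dact T i : (i < n)%N -> sgvec (dact (s n i) T) =1 refl_act i (sgvec T).
Proof. by apply: (vec_dact (q := fun x => if x.1 then -1 else 1)) => -[] c. Qed.

Lemma fD_root_val T i : fD mu m i T = root_val i (cvec mu m T).
Proof. by []. Qed.

Lemma cvec_flip T k : cvec mu m (flip T) k = if k == 0%N then - cvec mu m T 0 else cvec mu m T k.
Proof.
case: (ltnP k n) => kn; last first.
  have out (U : {ffun 'I_n -> bool * box la}) : cvec mu m U k = 0 by exact: vec_out.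
  by rewrite !out; case: eqP => //; lia.
have -> : 0%N = val (Ordinal (ltnW n2)) by [].
rewrite -[k]/(val (Ordinal kn)) !cvecE ffunE /=.
case: eqP => k0; last by rewrite addbF.
have -> : Ordinal kn = Ordinal (ltnW n2) by apply: val_inj.
by case: (T _).1; rewrite ?mulN1r ?mul1r ?opprK.
Qed.

Lemma fD_flip T : fD mu m 0 T = fD mu m 1 (flip T).
Proof. by rewrite /fD /= !cvec_flip /=; lia. Qed.

(** The exchange can only break the order if both entries have the same sign and share a row or a
    column. Having consecutive values, they then fill neighbouring boxes by [std_between], and f is
    1 or -1. *)
Lemma std_swapS T i : is_std mu T -> (i.+1 < n)%N -> fD mu m i.+1 T ^+ 2 != 1 ->
  is_std mu (dact (s n i.+1) T).
Proof.
move=> sT lin f2.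
have /is_stdP[iT hT rT cT] := sT.
have adj_f (p q : 'I_n) : (p = i :> nat /\ q = i.+1 :> nat) \/ (p = i.+1 :> nat /\ q = i :> nat) ->
    (T p).1 = (T q).1 -> content (T p).2 - content (T q).2 = 1 \/
      content (T p).2 - content (T q).2 = -1 -> False.
  move=> pq spq d; suff : fD mu m i.+1 T = 1 \/ fD mu m i.+1 T = -1.
    by move: f2 => /[swap] -[->|->]; rewrite ?sqrrN ?expr1n eqxx.
  rewrite /fD /=; case: pq d => -[pi qi]; (rewrite -qi -pi || rewrite -pi -qi);
    by rewrite !cvecE -spq /dcontent; case: (T p).1; lia.
have row_adj (p q : 'I_n) : (p = i :> nat /\ q = i.+1 :> nat) \/ (p = i.+1 :> nat /\ q = i :> nat) ->
    (T p).1 = (T q).1 -> (T p).2.1 = (T q).2.1 -> ((T p).2.2 < (T q).2.2)%N -> False.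
  move=> pq spq e lt; apply: (adj_f p q pq spq); right; rewrite /content e.
  have [->|ne] := eqVneq (nat_of_ord (T q).2.2) (T p).2.2.+1; first by lia.
  have [||||j [_ _]] := @std_between n la mu skew sz T p q (T p).2.1 (T p).2.2.+1 sT;
    rewrite ?e; try lia.
  by rewrite /entry !dvalE spq; case: (T q).1; case: (T j).1; lia.
have col_adj (p q : 'I_n) : (p = i :> nat /\ q = i.+1 :> nat) \/ (p = i.+1 :> nat /\ q = i :> nat) ->
    (T p).1 = (T q).1 -> (T p).2.2 = (T q).2.2 -> ((T p).2.1 < (T q).2.1)%N -> False.
  move=> pq spq e lt; apply: (adj_f p q pq spq); left; rewrite /content e.
  have [->|ne] := eqVneq (nat_of_ord (T q).2.1) (T p).2.1.+1; first by lia.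
  have [||||j [_ _]] := @std_between n la mu skew sz T p q (T p).2.1.+1 (T p).2.2 sT;
    rewrite ?e; try lia.
  by rewrite /entry !dvalE spq; case: (T q).1; case: (T j).1; lia.
pose y (k : 'I_n) := (s n i.+1 (false, k)).2.
have E k : dact (s n i.+1) T k = T (y k).
  by rewrite dact_s //= addbF -/(y k); case: (T (y k)).
have yE k : y k = swap_idx i.+1 k :> nat by rewrite /y s_snd.
have yi : injective y.
  move=> k l /(congr1 val) /=; rewrite !yE /swap_idx => e; apply: val_inj => /=.
  by move: e; split_ifs; lia.
have swap k l : entry T (y k) < entry T (y l) -> k != l ->
   ((y k = i :> nat /\ y l = i.+1 :> nat) \/ (y k = i.+1 :> nat /\ y l = i :> nat) ->
     (T (y k)).1 = (T (y l)).1 -> False) ->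
   entry (dact (s n i.+1) T) k < entry (dact (s n i.+1) T) l.
  rewrite /entry !E !dvalE !yE -(inj_eq val_inj) /= /swap_idx => h1 h2 h3; move: h1 h2 h3.
  by case: (T (y k)).1; case: (T (y l)).1; split_ifs; lia.
apply/is_stdP; split.
- by move=> k l; rewrite !E => /iT/yi.
- by move=> k; rewrite E.
- move=> k l; rewrite !E => e lt; apply: swap; first exact: rT.
    by apply: contraTneq lt => ->; rewrite ltnn.
  by move=> pq sg; apply: (row_adj _ _ pq sg e lt).
- move=> k l; rewrite !E => e lt; apply: swap; first exact: cT.
    by apply: contraTneq lt => ->; rewrite ltnn.
  by move=> pq sg; apply: (col_adj _ _ pq sg e lt).
Qed.

Lemma std_swap T i : is_std mu T -> (i < n)%N -> fD mu m i T ^+ 2 != 1 ->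
  is_std mu (dact (s n i) T).
Proof.
case: i => [|i] sT lin; last exact: std_swapS.
rewrite fD_flip dact_s0 // is_std_flip => f2.
by apply: std_swapS => //; rewrite is_std_flip.
Qed.

Lemma fD_neq0 T i : is_std mu T -> (i < n)%N -> fD mu m i T != 0.
Proof.
have main (U : {ffun 'I_n -> bool * box la}) j : is_std mu U -> (j.+1 < n)%N -> fD mu m j.+1 U != 0.
  move=> sU jn; rewrite /fD /= subr_eq0 eq_sym.
  by apply: (cvec_neq skew sz m0 (k := Ordinal (ltnW jn)) (l := Ordinal jn)) => //=; lia.
case: i => [|i] sT lin; last exact: main.
by rewrite fD_flip; apply: main; rewrite ?is_std_flip.
Qed.

(** The sum telescopes to a difference of contents two indices apart; for the edge between 0 and 2
    it does so after [flip]. *)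
Lemma fD_adj_neq0 T i j : is_std mu T -> (i < n)%N -> (j < n)%N -> adj i j ->
  fD mu m i T + fD mu m j T != 0.
Proof.
have main (U : {ffun 'I_n -> bool * box la}) k : is_std mu U -> (k.+2 < n)%N -> cvec mu m U k.+2 - cvec mu m U k != 0.
  move=> sU kn; rewrite subr_eq0 eq_sym.
  by apply: (cvec_neq skew sz m0 (k := Ordinal (ltnW (ltnW kn))) (l := Ordinal kn)) => //=; lia.
move=> sT lin ljn aij; move: i j aij lin ljn; apply: adj_ind => [||i|i] lin ljn;
  rewrite /fD /=.
- have := main (flip T) 0%N; rewrite is_std_flip !cvec_flip /= => /(_ sT ljn); lia.
- have := main (flip T) 0%N; rewrite is_std_flip !cvec_flip /= => /(_ sT lin); lia.
- by have := main T i sT ljn; lia.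
- by have := main T i sT lin; lia.
Qed.

(** The hypothesis on signs makes f, up to sign, a sum of two positive contents, so |f| >= 2. *)
Lemma fD_sgvec T i : is_std mu T -> (i < n)%N -> root_val i (sgvec T) != 0 ->
  fD mu m i T ^+ 2 != 1.
Proof.
move=> /is_stdP[_ hT _ _] lin.
have pos k : 0 < dcontent mu m (T k).2 by apply: dcontent_gt0.
have an : (i.-1 < n)%N by lia.
have bn : (maxn i 1 < n)%N by lia.
have e c : root_val i c = if i == 0%N then c (Ordinal an) + c (Ordinal bn) else c (Ordinal bn) - c (Ordinal an).
  by rewrite /root_val; case: i lin an bn => //= i *; have -> : maxn i.+1 1 = i.+1 by lia.
rewrite fD_root_val !e /sgvec !cvecE !vecE.
have := pos (Ordinal an); have := pos (Ordinal bn).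
move: (dcontent _ _ _) (dcontent _ _ _) => x y x0 y0 sg.
rewrite sqrf_eq1; move: sg.
by case: (T _).1; case: (T _).1; case: (i == 0%N); lia.
Qed.
End Swaps.

(** * Seminormal matrices *)

Section Seminormal.
Variables (R : rcfType) (n : nat) (F : finType) (P : pred F).
Variables (act : nat -> F -> F) (f : nat -> F -> int).
Local Notation B := {T : F | P T}.

Hypothesis f_neq0 : forall i T, P T -> (i < n)%N -> f i T != 0.
Hypothesis f_adj_neq0 : forall i j T, P T -> (i < n)%N -> (j < n)%N -> adj i j ->
  f i T + f j T != 0.
Hypothesis P_act : forall i T, P T -> (i < n)%N -> f i T ^+ 2 != 1 -> P (act i T).
Hypothesis actK : forall i T, (i < n)%N -> act i (act i T) = T.
Hypothesis act_far : forall i j T, (i < n)%N -> (j < n)%N -> i != j -> ~~ adj i j ->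
  act i (act j T) = act j (act i T).
Hypothesis act_adj : forall i j T, (i < n)%N -> (j < n)%N -> adj i j ->
  act i (act j (act i T)) = act j (act i (act j T)).
Hypothesis f_same : forall i T, (i < n)%N -> f i (act i T) = - f i T.
Hypothesis f_far : forall i j T, (i < n)%N -> (j < n)%N -> i != j -> ~~ adj i j ->
  f i (act j T) = f i T.
Hypothesis f_adj : forall i j T, (i < n)%N -> (j < n)%N -> adj i j ->
  f i (act j T) = f i T + f j T.

Definition beta (x : int) : R := Num.sqrt (1 - ((x%:~R : R) ^+ 2)^-1).

Definition sn_gen (i : nat) (T' T : B) : R :=
  (T' == T)%:R / (f i (val T))%:~R + (val T' == act i (val T))%:R * beta (f i (val T)).

(* The action of the matrices on row vectors, extended to functions on all of [F]:
   the value at [act i T] is irrelevant outside [P], as its coefficient vanishes. *)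
Definition sn_op (i : nat) (phi : F -> R) (T : F) : R :=
  phi T / (f i T)%:~R + beta (f i T) * phi (act i T).

Lemma beta_opp x : beta (- x) = beta x.
Proof. by rewrite /beta rmorphN sqrrN. Qed.

Lemma beta_sqr x : x != 0 -> beta x * beta x = 1 - (x%:~R)^-1 * (x%:~R)^-1.
Proof.
move=> x0; have x1 : (1 : R) <= x%:~R ^+ 2.
  have : (1 : int) <= x ^+ 2 by rewrite expr2; nia.
  by rewrite -(ler_int R) rmorphXn.
rewrite -expr2 sqr_sqrtr; first by rewrite expr2 invfM.
by rewrite subr_ge0 invf_le1 //; apply: lt_le_trans x1.
Qed.

(** Relations between the matrices can thus be checked pointwise, without asking which [act i T]
    satisfy [P]. *)
Lemma sum_sn_gen (phi : F -> R) i (T : B) : (i < n)%N ->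
  \sum_(U : B) phi (val U) * sn_gen i U T = sn_op i phi (val T).
Proof.
move=> lin; rewrite /sn_gen /sn_op.
under eq_bigr => U _ do rewrite mulrDr.
rewrite big_split /=; congr (_ + _).
  rewrite (bigD1 T) //= eqxx mul1r big1 ?addr0 // => U /negPf ->.
  by rewrite mul0r mulr0.
have [PT|nPT] := boolP (P (act i (val T))).
  rewrite (bigD1 (Sub _ PT : B)) //= eqxx mul1r mulrC big1 ?addr0 // => U.
  by rewrite -(inj_eq val_inj) /= => /negPf ->; rewrite mul0r mulr0.
have -> : beta (f i (val T)) = 0.
  have /eqP f2 : f i (val T) ^+ 2 == 1.
    by apply: contraNT nPT => f2; apply: P_act => //; apply: valP.
  by rewrite /beta -rmorphXn /= f2 invr1 subrr sqrtr0.
by rewrite mul0r big1 // => U _; rewrite !mulr0.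
Qed.

Definition sn_gen_mx (i : nat) : 'M[R]_#|{: B}| :=
  \matrix_(x, y) sn_gen i (enum_val x) (enum_val y).

Definition fun_row (phi : F -> R) : 'rV[R]_#|{: B}| := \row_y phi (val (enum_val y)).

Lemma eq_fun_row phi psi : (forall T, P T -> phi T = psi T) -> fun_row phi = fun_row psi.
Proof. by move=> e; apply/rowP => y; rewrite !mxE e //; apply: valP. Qed.

Lemma fun_row_sn_gen phi i : (i < n)%N -> fun_row phi *m sn_gen_mx i = fun_row (sn_op i phi).
Proof.
move=> lin; apply/rowP => y; rewrite !mxE -sum_sn_gen //.
rewrite (reindex _ (onW_bij _ (@enum_val_bij B))) /=.
by apply: eq_bigr => x _; rewrite !mxE.
Qed.

Lemma fun_row_ext (A A' : 'M[R]_#|{: B}|) :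
  (forall phi, fun_row phi *m A = fun_row phi *m A') -> A = A'.
Proof.
move=> e; apply/row_matrixP => x; rewrite !rowE.
suff -> : delta_mx 0 x = fun_row (fun T => (T == val (enum_val x))%:R) by apply: e.
apply/rowP => y; rewrite !mxE /= (inj_eq val_inj) (inj_eq enum_val_inj).
by rewrite eq_sym.
Qed.

Lemma sn_gen_mx_sq i : (i < n)%N -> sn_gen_mx i * sn_gen_mx i = 1.
Proof.
move=> lin; apply: fun_row_ext => phi.
rewrite -mulmxE mulmxA !fun_row_sn_gen // mulmx1; apply: eq_fun_row => T PT.
rewrite /sn_op actK // f_same // rmorphN invrN beta_opp.
move: (beta_sqr (f_neq0 PT lin)).
move: (beta _) (_^-1) => b a e.
rewrite -[RHS]mul1r -(_ : a * a + b * b = 1); first by ring.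
by rewrite e; ring.
Qed.

Lemma sn_gen_mx_far i j : (i < n)%N -> (j < n)%N -> i != j -> ~~ adj i j ->
  sn_gen_mx i * sn_gen_mx j = sn_gen_mx j * sn_gen_mx i.
Proof.
move=> lin ljn nij naij; apply: fun_row_ext => phi.
have naji : ~~ adj j i by move: naij; rewrite /adj; lia.
have nji : j != i by rewrite eq_sym.
rewrite -!mulmxE !mulmxA !fun_row_sn_gen //; apply: eq_fun_row => T PT.
by rewrite /sn_op !f_far // act_far //; ring.
Qed.

Lemma sn_gen_mx_adj i j : (i < n)%N -> (j < n)%N -> adj i j ->
  sn_gen_mx i * sn_gen_mx j * sn_gen_mx i = sn_gen_mx j * sn_gen_mx i * sn_gen_mx j.
Proof.
move=> lin ljn aij; apply: fun_row_ext => phi.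
have aji : adj j i by move: aij; rewrite /adj; lia.
rewrite -!mulmxE !mulmxA !fun_row_sn_gen //; apply: eq_fun_row => T PT.
rewrite /sn_op !actK // act_adj //.
set x := f i T; set y := f j T; set z := x + y.
have fji : f j (act i T) = z by rewrite f_adj // addrC.
have fij : f i (act j T) = z by rewrite f_adj.
have fii : f i (act i T) = - x by rewrite f_same.
have fjj : f j (act j T) = - y by rewrite f_same.
have fiji : f i (act j (act i T)) = y by rewrite f_adj // fji fii /z addKr.
have fjij : f j (act i (act j T)) = x by rewrite f_adj // fij fjj /z addrC addrK.
rewrite fji fij fii fjj fiji fjij !rmorphN !invrN !beta_opp.
have x0 : x != 0 by apply: f_neq0.
have y0 : y != 0 by apply: f_neq0.
have z0 : z != 0 by apply: f_adj_neq0.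
(* Together with the values of A^2 and B'^2, this consequence of z = x + y is all that the
   coefficient comparison needs. *)
have : (z%:~R : R)^-1 * ((x%:~R)^-1 + (y%:~R)^-1) = (x%:~R)^-1 * (y%:~R)^-1.
  have : (z%:~R : R) != 0 by rewrite intr_eq0.
  have : (x%:~R : R) != 0 by rewrite intr_eq0.
  have : (y%:~R : R) != 0 by rewrite intr_eq0.
  rewrite /z rmorphD /= => ? ? ?; by field; apply/and3P.
have := beta_sqr x0; have := beta_sqr y0.
move: (beta x) (beta y) (beta z) => A B' C.
move: (x%:~R^-1) (y%:~R^-1) (z%:~R^-1) => a b c.
move: (phi _) (phi _) (phi _) (phi _) (phi _) (phi _) => p1 p2 p3 p4 p5 p6.
move=> hB hA hc.
have e1 : a * a * b + A * A * c = a * b * b + B' * B' * c.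
  apply/eqP; rewrite -subr_eq0 hA hB.
  have -> : a * a * b + (1 - a * a) * c - (a * b * b + (1 - b * b) * c) =
            (a - b) * (a * b - c * (a + b)) by ring.
  by rewrite hc subrr mulr0.
have e2 : a * b - a * c = b * c by rewrite -hc; ring.
have e3 : a * b - b * c = a * c by rewrite -hc; ring.
(* Coefficients are collected at the six values of [phi]: [e1] matches the diagonal one, [e2] and
   [e3] those at the two single swaps, and the others agree already. *)
transitivity (p6 * (a * a * b + A * A * c) + p5 * A * (a * b - a * c) + p4 * B' * (a * c) +
  p3 * (a * B' * C) + p2 * (A * C * b) + p1 * (A * B' * C)); first by ring.
by rewrite e1 e2 -e3; ring.
Qed.

End Seminormal.

(** * Existence of the representation rho *)

Section RhoExists.
Variables (R : rcfType) (n : nat) (la mu : seq nat) (m : nat) (eps : bool).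
Hypothesis (n2 : (2 <= n)%N) (skew : is_skew_shape la mu) (sz : (sumn la - sumn mu)%N = n).
Hypothesis m0 : (0 < m)%N.
Implicit Types (T : {ffun 'I_n -> bool * box la}) (g h : {perm (bool * 'I_n)}).

Lemma dact1 T : dact 1 T = T.
Proof. by apply/ffunP => k; rewrite ffunE invg1 perm1 /=; case: (T k) => -[]. Qed.

Lemma dact_comp g h T : g \in Dn n -> h \in Dn n ->
  dact (Defs.comp g h) T = dact g (dact h T).
Proof.
move=> gD hD; apply/ffunP => k; rewrite !ffunE /Defs.comp invMg permM.
have hs := Dn_sneg (groupVr (G := Dn_group n) hD).
case: (g^-1%g _) => [b l] /=; rewrite ffunE; set y := h^-1%g (false, l).
have -> : h^-1%g (b, l) = (y.1 (+) b, y.2).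
  case: b; first by rewrite -[(true, l)]/(sneg (false, l)) hs addbT.
  by rewrite addbF -surjective_pairing.
by rewrite /=; case: (T y.2).1; case: y.1; case: b.
Qed.

Lemma odd_neg_dact g T : g \in Dn n ->
  odd #|[set k | (dact g T k).1]| = odd #|[set k | (T k).1]|.
Proof.
move=> gD; have hD := groupVr (G := Dn_group n) gD; have hs := Dn_sneg hD.
rewrite !odd_card_addb.
under eq_bigr => k _ do rewrite ffunE /= -[(_ != _)]/(~~ (_ == _)) negb_eqb.
rewrite big_split /= Dn_addb // addbF.
by rewrite -(reindex_inj (sneg_inj_snd hs) (P := xpredT) (F := fun i => (T i).1)).
Qed.

Lemma is_dtabE T : is_dtab mu eps T = is_std mu T && (odd #|[set k | (T k).1]| == eps).
Proof. by []. Qed.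

Lemma dtab_swap T i : is_dtab mu eps T -> (i < n)%N -> fD mu m i T ^+ 2 != 1 ->
  is_dtab mu eps (dact (s n i) T).
Proof.
rewrite !is_dtabE => /andP[sT oT] lin f2.
by rewrite (std_swap n2 skew sz m0) // odd_neg_dact ?Dn_s.
Qed.

Lemma rho_exists : exists rho : {perm (bool * 'I_n)} -> DT la mu n eps -> DT la mu n eps -> R,
  is_rep (Dn n) rho /\
  (forall i : nat, (i < n)%N -> forall x y, rho (s n i) x y = rhoGen la mu m eps i x y).
Proof.
pose P := @is_dtab la mu n eps.
pose act i T := dact (s n i) T.
pose f i T := fD mu m i T.
have f_neq0 i T : P T -> (i < n)%N -> f i T != 0.
  by move=> PT lin; have /andP[sT _] : is_dtab mu eps T := PT; apply: fD_neq0.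
have f_adj_neq0 i j T : P T -> (i < n)%N -> (j < n)%N -> adj i j -> f i T + f j T != 0.
  by move=> PT lin ljn aij; have /andP[sT _] : is_dtab mu eps T := PT; apply: fD_adj_neq0.
have P_act i T : P T -> (i < n)%N -> f i T ^+ 2 != 1 -> P (act i T).
  exact: dtab_swap.
have dM i j T : (i < n)%N -> (j < n)%N -> act i (act j T) = dact (s n j * s n i)%g T.
  by move=> lin ljn; rewrite -[(_ * _)%g]/(Defs.comp _ _) dact_comp ?Dn_s.
have actK i T : (i < n)%N -> act i (act i T) = T.
  by move=> lin; rewrite dM // sK // dact1.
have act_far i j T : (i < n)%N -> (j < n)%N -> i != j -> ~~ adj i j ->
  act i (act j T) = act j (act i T).
  by move=> lin ljn nij naij; rewrite !dM // (s_far n2 lin ljn nij naij).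
have act_adj i j T : (i < n)%N -> (j < n)%N -> adj i j ->
  act i (act j (act i T)) = act j (act i (act j T)).
  move=> lin ljn aij; rewrite dM // [RHS]dM // -!dact_comp ?groupM ?Dn_s //.
  by rewrite /Defs.comp mulgA (s_adj n2 lin ljn aij) mulgA.
have f_act i j T : (j < n)%N -> f i (act j T) = root_val i (refl_act j (cvec mu m T)).
  by move=> ljn; rewrite /f fD_root_val; apply: eq_root_val; apply: cvec_dact.
have f_same i T : (i < n)%N -> f i (act i T) = - f i T.
  by move=> lin; rewrite f_act // root_val_refl_act_same.
have f_far i j T : (i < n)%N -> (j < n)%N -> i != j -> ~~ adj i j -> f i (act j T) = f i T.
  by move=> lin ljn nij naij; rewrite f_act // root_val_refl_act_far.
have f_adj i j T : (i < n)%N -> (j < n)%N -> adj i j -> f i (act j T) = f i T + f j T.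
  by move=> lin ljn aij; rewrite f_act // root_val_refl_act_adj.
pose M := @sn_gen_mx R _ P act f.
have r_sq := sn_gen_mx_sq R f_neq0 P_act actK f_same.
have r_far := sn_gen_mx_far R P_act act_far f_far.
have r_adj := sn_gen_mx_adj R f_neq0 f_adj_neq0 P_act actK act_adj f_same f_adj.
pose rho g (x y : DT la mu n eps) : R := Dn_ext M g (enum_rank x) (enum_rank y).
exists rho; split; first split.
- by move=> x y; rewrite /rho (Dn_ext1 _ n2) mxE (inj_eq enum_rank_inj).
- move=> g h gD hD x z; rewrite /rho (Dn_extM n2 r_sq r_far r_adj) // mxE.
  by rewrite (reindex _ (onW_bij _ (@enum_rank_bij _))).
- move=> i lin x y; rewrite /rho (Dn_ext_gen n2 r_sq r_far r_adj) // mxE !enum_rankK.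
  by [].
Qed.
End RhoExists.

(** * Induced representations *)

Section FinMatrix.
Variable R : fieldType.

Definition fun_mx (A B : finType) (M : A -> B -> R) : 'M[R]_(#|A|, #|B|) :=
  \matrix_(x, y) M (enum_val x) (enum_val y).

Definition fun_mul (A B C : finType) (M : A -> B -> R) (N : B -> C -> R) (x : A) (z : C) : R :=
  \sum_y M x y * N y z.

Lemma fun_mx_mul (A B C : finType) (M : A -> B -> R) (N : B -> C -> R) :
  fun_mx M *m fun_mx N = fun_mx (fun_mul M N).
Proof.
apply/matrixP => x z; rewrite !mxE /fun_mul (reindex _ (onW_bij _ (@enum_val_bij B))) /=.
by apply: eq_bigr => y _; rewrite !mxE.
Qed.

Lemma fun_mx1 (A : finType) : fun_mx (fun x y : A => (x == y)%:R) = 1%:M.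
Proof. by apply/matrixP => x y; rewrite !mxE (inj_eq enum_val_inj). Qed.

Lemma eq_fun_mx (A B : finType) (M N : A -> B -> R) : (forall x y, M x y = N x y) -> fun_mx M = fun_mx N.
Proof. by move=> e; apply/matrixP => x y; rewrite !mxE e. Qed.

Lemma fun_mx_inj (A B : finType) (M N : A -> B -> R) : fun_mx M = fun_mx N -> forall x y, M x y = N x y.
Proof. by move=> /matrixP e x y; have := e (enum_rank x) (enum_rank y); rewrite !mxE !enum_rankK. Qed.

(** The product being 1 gives p <= q, so the matrices are square. A surjection between spaces whose
    dimensions satisfy one inequality becomes an isomorphism. *)
Lemma mulmx1C_leq p q (A : 'M[R]_(p, q)) (B : 'M[R]_(q, p)) : (q <= p)%N ->
  A *m B = 1%:M -> B *m A = 1%:M.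
Proof.
move=> qp AB; have pq : p = q by apply/eqP; rewrite eqn_leq qp (mulmx1_min AB).
by case: q / pq A B {qp} AB => A B; apply: mulmx1C.
Qed.
End FinMatrix.

(* [base_tab] spans a copy of sigma inside the restriction of rho to [H], and that copy
   generates rho. *)
Section InducedIso.
Variables (R : fieldType) (gT : finType) (G H : {group {perm gT}}) (X : {set {perm gT}}).
Variables (B1 B2 : finType) (rho : {perm gT} -> B1 -> B1 -> R)
  (sigma : {perm gT} -> B2 -> B2 -> R) (base_tab : B2 -> B1).
Hypotheses (HG : H \subset G) (rrep : is_rep G rho).
Hypothesis ltr : is_ltrans G H X.
Hypothesis base_tabP : forall h, h \in H -> forall T Q,
  rho h T (base_tab Q) = \sum_Q' (T == base_tab Q')%:R * sigma h Q' Q.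

Local Notation C := ({x | x \in X} * B2)%type.

Hypothesis base_tab_span : forall S : (B1 -> R) -> Prop,
  (forall u v, u =1 v -> S u -> S v) ->
  (forall a b u v, S u -> S v -> S (fun T => a * u T + b * v T)) ->
  (forall g u, g \in G -> S u -> S (fun T => \sum_U rho g T U * u U)) ->
  (forall Q, S (fun T => (T == base_tab Q)%:R)) ->
  forall T0, S (fun T => (T == T0)%:R).
Hypothesis card_le : (#|{: C}| <= #|B1|)%N.

(** Matrix of the map given by Frobenius reciprocity, sending (t, Q) to rho(t) applied to
    [base_tab Q]. *)
Definition ind_map (T : B1) (p : C) : R := rho (val p.1) T (base_tab p.2).

Lemma ltrans_coset g : g \in G -> exists x : {x | x \in X},
  Defs.comp (val x)^-1 g \in H /\
  forall y : {x | x \in X}, Defs.comp (val y)^-1 g \in H -> y = x.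
Proof.
move=> gG; have /andP[_ /forallP/(_ g)/implyP/(_ gG)/cards1P[x /setP e]] := ltr.
have := e x; rewrite !inE eqxx => /andP[xX xH].
exists (Sub x xX); split=> // y yH; apply: val_inj => /=.
by have := e (val y); rewrite !inE (valP y) yH => /esym/eqP.
Qed.

(** Write g = x h with x in the transversal and h in [H]: only pairs with first component x
    contribute, and [base_tabP] evaluates h. *)
Lemma ind_map_coset g T Q : g \in G ->
  rho g T (base_tab Q) = \sum_(q : C) ind_map T q *
    (if Defs.comp (val q.1)^-1 g \in H then sigma (Defs.comp (val q.1)^-1 g) q.2 Q else 0).
Proof.
move=> gG; have [x [xH xU]] := ltrans_coset gG.
have xG : val x \in G by have /andP[/subsetP XG _] := ltr; apply: XG; apply: valP.
rewrite -(pair_bigA _ (fun (y : {x | x \in X}) Q' => ind_map T (y, Q') *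
    (if Defs.comp (val y)^-1 g \in H then sigma (Defs.comp (val y)^-1 g) Q' Q else 0))) /=.
rewrite (bigD1 x) //= xH [X in _ + X]big1 ?addr0; last first.
  move=> y yx; apply: big1 => Q' _; case: ifP => [/xU e|_]; last by rewrite mulr0.
  by rewrite e eqxx in yx.
set h := Defs.comp _ g in xH *.
have {1}-> : g = Defs.comp (val x) h by rewrite /h /Defs.comp mulgKV.
rewrite (rrep.2 _ _ xG (subsetP HG _ xH)).
rewrite (eq_bigr (fun U => \sum_Q' rho (val x) T U * ((U == base_tab Q')%:R * sigma h Q' Q)));
  last by move=> U _; rewrite base_tabP // mulr_sumr.
rewrite exchange_big /=; apply: eq_bigr => Q' _.
rewrite (bigD1 (base_tab Q')) //= eqxx mul1r big1 ?addr0 // => U /negPf ->.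
by rewrite mul0r mulr0.
Qed.

Lemma ind_map_inter g : g \in G -> forall T p,
  \sum_U rho g T U * ind_map U p = \sum_q ind_map T q * Ind H X sigma g q p.
Proof.
move=> gG T [t Q]; have tG : val t \in G.
  by have /andP[/subsetP XG _] := ltr; apply: XG; apply: valP.
have gtG : Defs.comp g (val t) \in G by rewrite /Defs.comp groupM.
by rewrite -(rrep.2 _ _ gG tG) ind_map_coset.
Qed.

Lemma ind_iso : rep_iso G rho (Ind H X sigma).
Proof.
pose S (u : B1 -> R) := exists w : C -> R, forall T, u T = \sum_q ind_map T q * w q.
(* [S] is the image of [ind_map]; preimages of the basis vectors are the columns of a right
   inverse. *)
have Sall T0 : S (fun T => (T == T0)%:R).
  apply: base_tab_span => [u v e [w uw]|a b u v [w uw] [w' vw]|g u gG [w uw]|Q].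
  - by exists w => T; rewrite -e.
  - exists (fun q => a * w q + b * w' q) => T; rewrite uw vw !mulr_sumr -big_split /=.
    by apply: eq_bigr => q _; ring.
  - exists (fun q => \sum_p Ind H X sigma g q p * w p) => T.
    under eq_bigr => U _ do rewrite uw mulr_sumr.
    under [RHS]eq_bigr => q _ do rewrite mulr_sumr.
    rewrite exchange_big [RHS]exchange_big /=; apply: eq_bigr => p _.
    under eq_bigr => U _ do rewrite mulrA.
    rewrite -mulr_suml ind_map_inter // mulr_suml.
    by apply: eq_bigr => q _; rewrite mulrA.
  - exists (fun q => if Defs.comp (val q.1)^-1 1%g \in H
                     then sigma (Defs.comp (val q.1)^-1 1%g) q.2 Q else 0) => T.
    by rewrite -ind_map_coset ?group1 // rrep.1.
have [W WP] := fin_all_exists Sall.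
pose P (q : C) (T : B1) := W T q.
have PQ : fun_mx ind_map *m fun_mx P = 1%:M.
  by rewrite fun_mx_mul -fun_mx1; apply: eq_fun_mx => T T0; rewrite WP.
have QP := mulmx1C_leq card_le PQ.
exists P, ind_map; split; last split.
- by apply: fun_mx_inj; rewrite fun_mx1 -QP fun_mx_mul.
- by apply: fun_mx_inj; rewrite fun_mx1 -PQ fun_mx_mul.
move=> g gG; apply: (@fun_mx_inj _ _ _ (fun_mul P (rho g)) (fun_mul (Ind H X sigma g) P)).
rewrite -!fun_mx_mul -[RHS]mul1mx -QP.
(* The inverse of an intertwiner intertwines. *)
have E : fun_mx (rho g) *m fun_mx ind_map = fun_mx ind_map *m fun_mx (Ind H X sigma g).
  by rewrite !fun_mx_mul; apply: eq_fun_mx; apply: ind_map_inter.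
by rewrite -!mulmxA [X in _ = _ *m X]mulmxA -E -!mulmxA PQ mulmx1.
Qed.
End InducedIso.

(** * Base tableaux *)

(* S_n^1 for [eps = false] and S_n^0 for [eps = true]: the generator left out is s_eps. *)
Definition Hn (n : nat) (eps : bool) : {set {perm (bool * 'I_n)}} :=
  <<[set s n (val i) | i : 'I_n & val i != eps :> nat]>>%g.

Lemma Sn1_Hn n : Sn1 n = Hn n false.
Proof.
rewrite /Sn1 /Hn; congr << _ >>%g; apply/setP => g.
by apply/imsetP/imsetP => -[i]; rewrite inE => i0 ->; exists i => //; rewrite inE; move: i0;
  rewrite lt0n.
Qed.

Section Parabolic.
Variables (n : nat) (eps : bool).
Hypothesis n2 : (2 <= n)%N.
Implicit Types (g h : {perm (bool * 'I_n)}) (x : bool * 'I_n).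

Lemma Hn_s i : (i < n)%N -> i != eps :> nat -> s n i \in Hn n eps.
Proof.
move=> lin ie; apply: mem_gen; apply/imsetP; exists (Ordinal lin) => //.
by rewrite inE.
Qed.

Lemma Hn_sub : Hn n eps \subset Dn n.
Proof.
rewrite (gen_subG _ (Dn_group n)); apply/subsetP => g /imsetP[i _ ->].
exact: (Dn_s n2 (ltn_ord i)).
Qed.

(* Tells whether [x] lies outside {(-1)^eps 1, 2, .., n}, the set stabilised by [Hn n eps]. *)
Definition base_sign x : bool := x.1 (+) (eps && (x.2 == 0%N :> nat)).

Lemma base_sign_s i x : (i < n)%N -> i != eps :> nat -> base_sign (s n i x) = base_sign x.
Proof.
move=> lin ie; rewrite /base_sign s_fst // s_snd //; move: ie.
case: x => b k /=; case: i lin => [|i] lin; case: eps => //= ie; rewrite /swap_idx;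
  by case: b; split_ifs; lia.
Qed.

(** The parabolic subgroup is the full stabiliser of its set of signed numbers: s_eps is never a
    descent of a stabilising element, so stripping descents uses generators of [Hn] only. *)
Lemma base_sign_mem g : g \in Dn n -> (forall x, base_sign (g^-1%g x) = base_sign x) -> g \in Hn n eps.
Proof.
move: g; apply: Dn_ind => // i g lin gD fi IH eg.
have ie : i != eps :> nat.
  (* For [eps = false] the first two coordinates are positive. For [eps = true] the first is at most
     1 and the second at least -1, and their absolute values differ, so the difference is
     positive. *)
  apply: contraTN fi => /eqP ie.
  have p0 : pvec g 0 = _ := vecE _ (Ordinal (ltnW n2)).
  have p1 : pvec g 1 = _ := vecE _ (Ordinal n2).
  have := eg (false, Ordinal (ltnW n2)); have := eg (false, Ordinal n2).
  have := pvec_neq gD (ltnW n2) n2 isT.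
  rewrite -leNgt /root_val ie /base_sign; case: eps; rewrite /= p0 p1 /sgnval /dval;
  move: (g^-1%g _) (g^-1%g _) => [b k] [c l] /=;
  by case: b; case: c; rewrite /=; lia.
have gH : Defs.comp (s n i) g \in Hn n eps.
  by apply: IH => x; rewrite /Defs.comp invMg sV // permM eg base_sign_s.
rewrite -(comp_sK n2 g lin) [X in X \in _]/Defs.comp groupM //; exact: Hn_s.
Qed.
End Parabolic.

(** The conditions at s_0 and s_1 make the second sign positive, monotonicity the later ones, and
    parity determines the first. *)
Lemma sgvec_ge0 (la : seq nat) n eps (T : {ffun 'I_n -> bool * box la}) : (2 <= n)%N ->
  (forall i, (i < n)%N -> 0 <= root_val i (sgvec T)) ->
  odd #|[set k | (T k).1]| = eps -> forall k, (T k).1 = eps && (k == 0%N :> nat).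
Proof.
move=> n2 nd oT.
have sE (k : 'I_n) : sgvec T k = if (T k).1 then -1 else 1 by rewrite /sgvec vecE.
have pos j : (j.+1 < n)%N -> sgvec T j.+1 = 1.
  elim: j => [|j IH] jn.
    have := nd _ (ltnW jn); have := nd _ jn; rewrite /root_val /=.
    by have := sE (Ordinal jn); have := sE (Ordinal (ltnW jn)) => /= -> ->; do 2 case: ifP.
  have := nd _ jn; rewrite /root_val /= (IH (ltnW jn)).
  by have := sE (Ordinal jn) => /= ->; case: ifP.
have TS (k : 'I_n) : k != 0%N :> nat -> (T k).1 = false.
  case: k => [[|j] jn] //= _.
  by have := sE (Ordinal jn); rewrite /= pos //; case: ifP.
move=> k; case: eqP => k0; last by rewrite andbF TS //; apply/eqP.
rewrite andbT -oT odd_card_addb (bigD1 k) //= big1 ?addbF // => j jk.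
by apply: TS; apply: contra jk => /eqP j0; apply/eqP/val_inj; rewrite /= j0.
Qed.

Section Base.
Variables (R : rcfType) (n : nat) (la mu : seq nat) (m : nat) (eps : bool).
Hypothesis (n2 : (2 <= n)%N) (skew : is_skew_shape la mu) (sz : (sumn la - sumn mu)%N = n).
Hypothesis m0 : (0 < m)%N.
Implicit Types (q : {ffun 'I_n -> box la}).

Definition base_fill q : {ffun 'I_n -> bool * box la} :=
  [ffun k : 'I_n => (eps && (k == 0%N :> nat), q k)].

Lemma base_fill_snd q (k : 'I_n) : (base_fill q k).2 = q k. Proof. by rewrite ffunE. Qed.
Lemma base_fill_fst q (k : 'I_n) : (base_fill q k).1 = eps && (k == 0%N :> nat). Proof. by rewrite ffunE. Qed.

Lemma base_fill_inj : injective base_fill.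
Proof. by move=> q q' e; apply/ffunP => k; rewrite -!base_fill_snd e. Qed.

Lemma is_std_base_fill q : is_std mu (base_fill q) = is_syt mu q.
Proof.
rewrite /is_std /is_syt.
have dv (k l : 'I_n) : (dval (base_fill q k).1 k < dval (base_fill q l).1 l) = (k < l)%N.
  rewrite !base_fill_fst !dvalE; case: eps => //=.
  by case: (nat_of_ord k) => [|?]; case: (nat_of_ord l) => [|?] /=; lia.
congr (_ && _ && _ && _).
- by apply/injectiveP/injectiveP => iq k l; [rewrite -!base_fill_snd | rewrite !base_fill_snd]; apply: iq.
- by apply: eq_forallb => k; rewrite base_fill_snd.
- by apply: eq_forallb => k; apply: eq_forallb => l; rewrite dv !base_fill_snd.
- by apply: eq_forallb => k; apply: eq_forallb => l; rewrite dv !base_fill_snd.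
Qed.

Lemma odd_neg_base_fill q : odd #|[set k | (base_fill q k).1]| = eps.
Proof.
rewrite odd_card_addb (bigD1 (Ordinal (ltnW n2))) //= base_fill_fst eqxx andbT big1 ?addbF // => k.
rewrite base_fill_fst -(inj_eq val_inj) /= => /negPf ->; exact: andbF.
Qed.

Lemma is_dtab_base_fill q : is_dtab mu eps (base_fill q) = is_syt mu q.
Proof. by rewrite is_dtabE is_std_base_fill odd_neg_base_fill eqxx andbT. Qed.

Definition base_tab (Q : SYT la mu n) : DT la mu n eps :=
  Sub (base_fill (val Q)) (etrans (is_dtab_base_fill (val Q)) (valP Q)).

Lemma val_base_tab Q : val (base_tab Q) = base_fill (val Q). Proof. by []. Qed.

(** [maxn i 1] is the identification with S_n: for [eps = true], s_0 exchanges the entries -1 and 2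
    just as (1 2) exchanges 1 and 2. *)
Lemma dact_base_fill q i : (i < n)%N -> i != eps :> nat ->
  dact (s n i) (base_fill q) = base_fill (swapQ (maxn i 1) q).
Proof.
move=> lin ie; apply/ffunP => k; rewrite dact_s // base_fill_fst base_fill_snd [RHS]ffunE /swapQ ffunE.
congr pair; last first.
  congr (q _); apply: val_inj; rewrite /= s_snd // tpE; try lia.
  by rewrite /= /swap_idx; case: i lin ie => [|i] lin ie //; have -> : maxn i.+1 1 = i.+1 by lia.
have := base_sign_s n2 (false, k) lin ie; rewrite /base_sign s_fst //=.
by case: (eps && _); case: (eps && _); case: (_ && _).
Qed.

(** The shift by [m] and the minimal content cancels; for s_0 it does so because the entry -1 turns
    the sum c_1 + c_2 into a difference. *)
Lemma fD_base_fill q i : (i < n)%N -> i != eps :> nat ->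
  fD mu m i (base_fill q) = cQ q (maxn i 1) - cQ q (maxn i 1).-1.
Proof.
have cv (k : 'I_n) : cvec mu m (base_fill q) k = (if eps && (k == 0%N :> nat) then -1 else 1) *
    (content (q k) - minc la mu + m%:Z) by rewrite cvecE base_fill_fst base_fill_snd.
have cq (k : 'I_n) : cQ q k = content (q k) by rewrite /cQ valK.
move=> lin ie; have an : (i.-1 < n)%N by lia.
have bn : (maxn i 1 < n)%N by lia.
have := cv (Ordinal an); have := cv (Ordinal bn); have := cq (Ordinal an); have := cq (Ordinal bn).
rewrite /fD /=; case: i lin ie an bn => [|i] lin ie an bn; move: ie; rewrite /=.
  by case: eps => // _; rewrite /maxn /= => -> -> -> ->; lia.
move: (q (Ordinal bn)) (q (Ordinal an)) => b a.
have -> : maxn i.+1 1 = i.+1 by lia.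
move=> ie /= -> -> -> ->.
have -> : eps && (i == 0%N) = false by move: ie; case: eps => //=; case: i {lin an bn}.
by rewrite andbF; lia.
Qed.

Variables (rho : {perm (bool * 'I_n)} -> DT la mu n eps -> DT la mu n eps -> R).
Hypothesis rrep : is_rep (Dn n) rho.
Hypothesis rgen : forall i : nat, (i < n)%N ->
  forall x y, rho (s n i) x y = rhoGen la mu m eps i x y.

Lemma rhoGen_base_tab i (T : DT la mu n eps) (Q : SYT la mu n) : (i < n)%N -> i != eps :> nat ->
  rhoGen la mu m eps i T (base_tab Q) =
  \sum_Q' (T == base_tab Q')%:R * yof la mu (maxn i 1) Q' Q :> R.
Proof.
move=> lin ie; rewrite /rhoGen /yof val_base_tab fD_base_fill // dact_base_fill //.
set h : R := _%:~R; set j := maxn i 1.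
under eq_bigr => Q' _ do rewrite mulrDr.
rewrite big_split /=; congr (_ + _).
  rewrite (bigD1 Q) //= eqxx mulrA mulr1 big1 ?addr0 // => Q' /negPf ->.
  by rewrite mul0r mulr0.
have [swap_idx|nsw] := boolP (is_syt mu (swapQ j (val Q))).
  rewrite (bigD1 (Sub _ swap_idx : SYT la mu n)) //= eqxx mul1r big1 ?addr0; last first.
    by move=> Q'; rewrite -(inj_eq val_inj) /= => /negPf ->; rewrite mul0r mulr0.
  by rewrite -(inj_eq val_inj) /=.
(* If the swapped filling is not standard, neither side has a basis vector equal to it. *)
rewrite big1 => [|Q' _]; last first.
  case: (val Q' =P _) => e; last by rewrite mul0r mulr0.
  by rewrite -e (valP Q') in nsw.
case: eqP => e; last by rewrite mul0r.
by move: (valP T) nsw; rewrite /= e is_dtab_base_fill => ->.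
Qed.

Lemma base_tab_inter (sigma : {perm (bool * 'I_n)} -> SYT la mu n -> SYT la mu n -> R) :
  is_rep (Hn n eps) sigma ->
  (forall i, (i < n)%N -> i != eps :> nat ->
     forall x y, sigma (s n i) x y = yof la mu (maxn i 1) x y) ->
  forall h, h \in Hn n eps -> forall (T : DT la mu n eps) (Q : SYT la mu n),
    rho h T (base_tab Q) = \sum_Q' (T == base_tab Q')%:R * sigma h Q' Q.
Proof.
move=> srep sn_gen h /gen_prodgP[N [c cA ->]].
pose K h := h \in Hn n eps /\ forall (T : DT la mu n eps) (Q : SYT la mu n),
    rho h T (base_tab Q) = \sum_Q' (T == base_tab Q')%:R * sigma h Q' Q.
suff [] : K (\prod_(i < N) c i)%g by [].
apply: (big_ind K) => [|x y [xH Kx] [yH Ky]|k _].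
- split=> [|T Q]; first exact: group1.
  rewrite rrep.1 (bigD1 Q) //= srep.1 eqxx mulr1 big1 ?addr0 // => Q' /negPf e.
  by rewrite srep.1 e mulr0.
- split=> [|T Q]; first exact: groupM.
  have xD := subsetP (Hn_sub eps n2) _ xH; have yD := subsetP (Hn_sub eps n2) _ yH.
  rewrite -[(x * y)%g]/(Defs.comp y x) rrep.2 //.
  rewrite (eq_bigr (fun U => \sum_Q1 rho y T U * ((U == base_tab Q1)%:R * sigma x Q1 Q)));
    last by move=> U _; rewrite Kx mulr_sumr.
  rewrite exchange_big /=.
  rewrite (eq_bigr (fun Q1 => \sum_Q' (T == base_tab Q')%:R * sigma y Q' Q1 * sigma x Q1 Q)).
    rewrite exchange_big /=; apply: eq_bigr => Q' _; rewrite srep.2 // mulr_sumr.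
    by apply: eq_bigr => Q1 _; rewrite mulrA.
  move=> Q1 _; rewrite (bigD1 (base_tab Q1)) //= eqxx mul1r big1 ?addr0; last first.
    by move=> U /negPf ->; rewrite mul0r mulr0.
  by rewrite Ky mulr_suml.
- have /imsetP[i] := cA k; rewrite inE => ie ->; split=> [|T Q]; first exact: (Hn_s (ltn_ord i) ie).
  rewrite (rgen (ltn_ord i)) (rhoGen_base_tab _ _ (ltn_ord i) ie).
  by apply: eq_bigr => Q' _; rewrite (sn_gen _ (ltn_ord i) ie).
Qed.

(** If the signs of T0 have a descent i, then T1 = T0^{s_i} is closer to a base tableau and T0 is
    recovered from T1 and its image under s_i. Without descents T0 is a base tableau. *)
Lemma base_tab_span (S : (DT la mu n eps -> R) -> Prop) :
  (forall u v, u =1 v -> S u -> S v) ->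
  (forall a b u v, S u -> S v -> S (fun T => a * u T + b * v T)) ->
  (forall g u, g \in Dn n -> S u -> S (fun T => \sum_U rho g T U * u U)) ->
  (forall Q, S (fun T => (T == base_tab Q)%:R)) ->
  forall T0 : DT la mu n eps, S (fun T => (T == T0)%:R).
Proof.
move=> Sext Slin Sact Siota T0.
have [N] := ubnP `|sqdist n (sgvec (val T0))|; elim: N T0 => // N IH T0 ltN.
have /andP[sT0 /eqP oT0] : is_dtab mu eps (val T0) := valP T0.
case: (pickP (fun i : 'I_n => root_val i (sgvec (val T0)) < 0)) => [i fi|nd]; last first.
  have nd' i : (i < n)%N -> 0 <= root_val i (sgvec (val T0)).
    by move=> lin; rewrite leNgt; have := nd (Ordinal lin) => /= ->.
  pose q : {ffun 'I_n -> box la} := [ffun k => (val T0 k).2].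
  have e : val T0 = base_fill q.
    apply/ffunP => k; rewrite [RHS]ffunE [in RHS]ffunE -(sgvec_ge0 n2 nd' oT0).
    by case: (val T0 k).
  have sq : is_syt mu q by rewrite -is_dtab_base_fill -e; apply: valP.
  apply: Sext (Siota (Sub q sq)) => T /=; congr (_ == _)%:R.
  by apply: val_inj; rewrite /= e.
have lin := ltn_ord i; have f2 := fD_sgvec n2 skew sz m0 sT0 lin (ltr0_neq0 fi).
have T1P := dtab_swap n2 skew sz m0 (valP T0) lin f2.
pose T1 : DT la mu n eps := Sub _ T1P.
have sT1 : S (fun T => (T == T1)%:R).
  apply: IH; have := sqdist_refl_act n2 (sgvec (val T0)) lin.
  rewrite -(eq_sqdist n (sgvec_dact n2 (val T0) lin)).
  have := sqdist_ge0 n (sgvec (val T0)); have := sqdist_ge0 n (sgvec (dact (s n i) (val T0))).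
  by move: ltN fi; rewrite /T1 /=; lia.
have back : dact (s n i) (val T1) = val T0.
  by rewrite /= -dact_comp ?Dn_s // /Defs.comp sK // dact1.
set f := fD mu m i (val T1); have fE : f = - fD mu m i (val T0).
  by rewrite /f fD_root_val (eq_root_val _ (cvec_dact mu n2 m (val T0) lin)) root_val_refl_act_same.
have b0 : beta R f != 0.
  apply: contra f2 => /eqP; rewrite fE beta_opp => b0.
  have := beta_sqr R (fD_neq0 n2 skew sz m0 sT0 lin).
  rewrite b0 mul0r -invfM => /esym/eqP; rewrite subr_eq0 eq_sym invr_eq1 -rmorphM /=.
  by rewrite (eqr_int R _ 1) -expr2.
(* This solves rho(s_i) T1 = T1 / f + beta(f) T0 for T0. *)
have := Slin (beta R f)^-1 (- (beta R f)^-1 / f%:~R) _ _ (Sact _ _ (Dn_s n2 lin) sT1) sT1.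
apply: Sext => T; rewrite (bigD1 T1) //= eqxx mulr1 big1 ?addr0; last first.
  by move=> U /negPf ->; rewrite mulr0.
rewrite rgen // /rhoGen -/(beta R _) back -/f (inj_eq val_inj).
move: (beta R f) b0 (f%:~R^-1) => b b0 c.
by rewrite mulrDr [X in _ + X + _]mulrCA mulVf // mulr1; ring.
Qed.

(** * Dimension of the induced representation *)

Lemma dact_sign (g : {perm (bool * 'I_n)}) q (k : 'I_n) :
  (dact g (base_fill q) k).1 = base_sign eps (g^-1%g (false, k)).
Proof. by rewrite ffunE /= base_fill_fst /base_sign; case: (_ && _); case: (_.1). Qed.

(** Whether a sign-changing move keeps a filling standard is read off its signs, so one [g] serves
    all [q]. [Q0] merely provides a filling on which to measure the sign pattern of t. *)
Lemma sort_signs (Q0 : SYT la mu n) t : t \in Dn n -> exists2 g, g \in Dn n &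
  forall q, is_syt mu q -> is_std mu (dact g (base_fill q)) /\
    forall k, (dact g (base_fill q) k).1 = base_sign eps (t^-1%g (false, k)).
Proof.
pose sg (t : {perm (bool * 'I_n)}) := sgvec (dact t (base_fill (val Q0))).
have [N] := ubnP `|sqdist n (sg t)|; elim: N t => // N IH t ltN tD.
have sgE g q : (forall k, (dact g (base_fill q) k).1 = base_sign eps (t^-1%g (false, k))) ->
  sgvec (dact g (base_fill q)) =1 sg t.
  by move=> e k; apply: eq_vec => l; rewrite e dact_sign.
case: (pickP (fun i : 'I_n => root_val i (sg t) < 0)) => [i fi|nd]; last first.
  have nd' i : (i < n)%N -> 0 <= root_val i (sg t).
    by move=> lin; rewrite leNgt; have := nd (Ordinal lin) => /= ->.
  have oT : odd #|[set k | (dact t (base_fill (val Q0)) k).1]| = eps.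
    by rewrite odd_neg_dact // odd_neg_base_fill.
  exists 1%g; first exact: (group1 (Dn_group n)).
  move=> q sq; rewrite dact1 is_std_base_fill; split=> // k.
  by rewrite base_fill_fst -(sgvec_ge0 n2 nd' oT) dact_sign.
have lin := ltn_ord i; pose t1 := Defs.comp (s n i) t.
have t1D : t1 \in Dn n by apply: Dn_comp_s.
have sg1 : sg t1 =1 refl_act i (sg t).
  by move=> k; rewrite /sg dact_comp ?Dn_s // sgvec_dact.
have [|g1 g1D g1P] := IH t1 _ t1D.
  have := sqdist_refl_act n2 (sg t) lin; rewrite -(eq_sqdist n sg1).
  by have := sqdist_ge0 n (sg t); have := sqdist_ge0 n (sg t1); move: ltN fi; lia.
exists (Defs.comp (s n i) g1); first exact: Dn_comp_s.
move=> q sq; have [std1 sgn1] := g1P q sq.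
have sgv1 : sgvec (dact g1 (base_fill q)) =1 sg t1.
  by move=> k; apply: eq_vec => l; rewrite sgn1 dact_sign.
rewrite dact_comp ?Dn_s //; split.
  apply: (std_swap n2 skew sz m0) => //; apply: (fD_sgvec n2 skew sz m0) => //.
  by rewrite (eq_root_val _ sgv1) (eq_root_val _ sg1) root_val_refl_act_same oppr_eq0 ltr0_neq0.
move=> k; have := sgn1 (s n i (false, k)).2.
rewrite dact_s //= => ->.
have -> x : t^-1%g x = t1^-1%g (s n i x).
  by rewrite /t1 /Defs.comp invMg sV // permM -[s n i (s n i x)]permM sK // perm1.
have t1s := Dn_sneg (groupVr (G := Dn_group n) t1D).
case E : (s n i (false, k)) => [b l] /=.
have -> : (i == 0%N :> nat) && (k < 2)%N = b by rewrite -[b]/((b, l).1) -E s_fst.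
case: b {E}; last by rewrite addbF.
by rewrite -[(true, l)]/(sneg (false, l)) t1s /base_sign /= addNb addbT.
Qed.

(** The injection sends (t, Q) to the filling obtained from Q by the element that [sort_signs]
    attaches to t. Its signs determine the coset of t by [base_sign_mem], hence t in the
    transversal; undoing the action then gives Q. *)
Lemma card_ind_le (X : {set {perm (bool * 'I_n)}}) : is_ltrans (Dn n) (Hn n eps) X ->
  (#|{: {x | x \in X} * SYT la mu n}| <= #|{: DT la mu n eps}|)%N.
Proof.
move=> ltr; case: (pickP (predT : pred (SYT la mu n))) => [Q0 _|noQ]; last first.
  by rewrite card_prod (eq_card0 noQ) muln0.
have XD (t : {x | x \in X}) : val t \in Dn n.
  by have /andP[/subsetP XG _] := ltr; apply: XG; apply: valP.
have [|G GP] := fin_all_exists (T := {: {x | x \in X}}) (U := fun=> {perm (bool * 'I_n)})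
  (P := fun t g => g \in Dn n /\ forall q, is_syt mu q -> is_std mu (dact g (base_fill q)) /\
    forall k, (dact g (base_fill q) k).1 = base_sign eps ((val t)^-1%g (false, k))).
  by move=> t; have [g gD gP] := sort_signs Q0 (XD t); exists g.
have dtP (p : {x | x \in X} * SYT la mu n) : is_dtab mu eps (dact (G p.1) (base_fill (val p.2))).
  have [gD gP] := GP p.1; rewrite is_dtabE odd_neg_dact // odd_neg_base_fill eqxx andbT.
  by have [] := gP _ (valP p.2).
pose F p : DT la mu n eps := Sub _ (dtP p).
apply: (@leq_card _ _ F) => -[t Q] [t' Q'] /(congr1 val) /= e.
have [gD gP] := GP t; have [gD' gP'] := GP t'.
have [_ sgn] := gP _ (valP Q); have [_ sgn'] := gP' _ (valP Q').
have eF k : base_sign eps ((val t)^-1%g (false, k)) = base_sign eps ((val t')^-1%g (false, k)).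
  by rewrite -sgn -sgn' e.
have eT x : base_sign eps ((val t)^-1%g x) = base_sign eps ((val t')^-1%g x).
  have ts := Dn_sneg (groupVr (G := Dn_group n) (XD t)).
  have ts' := Dn_sneg (groupVr (G := Dn_group n) (XD t')).
  case: x => [[] k]; last exact: eF.
  rewrite -[(true, k)]/(sneg (false, k)) ts ts' /base_sign /= !addNb; congr (~~ _); exact: eF.
have hH : Defs.comp (val t)^-1%g (val t') \in Hn n eps.
  apply: base_sign_mem => //.
    by apply: Dn_comp; rewrite ?(groupV (Dn_group n)); apply: XD.
  by move=> y; rewrite /Defs.comp invMg invgK permM -eT permK.
have hH' : Defs.comp (val t')^-1%g (val t') \in Hn n eps.
  by rewrite /Defs.comp mulgV group1.
have tt : t = t'.
  have [x [_ xU]] := ltrans_coset (H := [group of Hn n eps]) ltr (XD t').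
  by rewrite (xU _ hH) (xU _ hH').
rewrite -tt in e *; congr pair; apply: val_inj; apply: base_fill_inj.
have gVD : (G t)^-1%g \in Dn n by rewrite (groupV (Dn_group n)).
by move: (congr1 (dact (G t)^-1%g) e); rewrite -!dact_comp // /Defs.comp mulgV !dact1.
Qed.

Lemma rho_iso (X : {set {perm (bool * 'I_n)}})
    (sigma : {perm (bool * 'I_n)} -> SYT la mu n -> SYT la mu n -> R) :
  is_ltrans (Dn n) (Hn n eps) X -> is_rep (Hn n eps) sigma ->
  (forall i, (i < n)%N -> i != eps :> nat ->
     forall x y, sigma (s n i) x y = yof la mu (maxn i 1) x y) ->
  rep_iso (Dn n) rho (Ind (Hn n eps) X sigma).
Proof.
move=> ltr srep sn_gen.
exact: (ind_iso (G := Dn_group n) (H := [group of Hn n eps]) (Hn_sub eps n2) rrep ltr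
         (base_tab_inter srep sn_gen) base_tab_span (card_ind_le ltr)).
Qed.
End Base.

Theorem theorem5p5 (R : rcfType) (n : nat) (la mu : seq nat) :
  (2 <= n)%N -> is_skew_shape la mu -> (sumn la - sumn mu)%N = n ->
  forall m : nat, (0 < m)%N ->
  (* (1)  rho^{la,m,+}  ~=  S^la induced from S_n^1 to D_n *)
  (exists rho : {perm (bool * 'I_n)} -> DT la mu n false -> DT la mu n false -> R,
     is_rep (Dn n) rho /\
     (forall i : nat, (i < n)%N -> forall x y, rho (s n i) x y = rhoGen la mu m false i x y) /\
     (forall (X : {set {perm (bool * 'I_n)}})
             (sigma : {perm (bool * 'I_n)} -> SYT la mu n -> SYT la mu n -> R),
        is_ltrans (Dn n) (Sn1 n) X ->
        is_rep (Sn1 n) sigma ->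
        (forall i : nat, (1 <= i < n)%N -> forall x y, sigma (s n i) x y = yof la mu i x y) ->
        rep_iso (Dn n) rho (Ind (Sn1 n) X sigma))) /\
  (* (2)  rho^{la,m,-}  ~=  S^la induced from S_n^0 to D_n *)
  (exists rho : {perm (bool * 'I_n)} -> DT la mu n true -> DT la mu n true -> R,
     is_rep (Dn n) rho /\
     (forall i : nat, (i < n)%N -> forall x y, rho (s n i) x y = rhoGen la mu m true i x y) /\
     (forall (X : {set {perm (bool * 'I_n)}})
             (sigma : {perm (bool * 'I_n)} -> SYT la mu n -> SYT la mu n -> R),
        is_ltrans (Dn n) (Sn0 n) X ->
        is_rep (Sn0 n) sigma ->
        (forall x y, sigma (s n 0) x y = yof la mu 1 x y) ->
        (forall i : nat, (2 <= i < n)%N -> forall x y, sigma (s n i) x y = yof la mu i x y) ->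
        rep_iso (Dn n) rho (Ind (Sn0 n) X sigma))).
Proof.
move=> n2 skew sz m m0; split.
  have [rho [rrep rgen]] := rho_exists R false n2 skew sz m0.
  exists rho; do 2!split => //; rewrite Sn1_Hn => X sigma ltr srep sn_gen.
  apply: (rho_iso n2 skew sz m0 rrep rgen ltr srep) => i lin i0 x y.
  by rewrite sn_gen; [congr (yof _ _ _ _ _); lia | lia].
have [rho [rrep rgen]] := rho_exists R true n2 skew sz m0.
exists rho; do 2!split => //; move=> X sigma ltr srep sn_gen0 sn_gen.
apply: (rho_iso n2 skew sz m0 rrep rgen ltr srep) => -[|i] lin i1 x y; first exact: sn_gen0.
by rewrite sn_gen; [congr (yof _ _ _ _ _); lia | move: i1; lia].
Qed.
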